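(* The subgroup $\{g\in\mathrm{SO}(8): g\cdot\omega_{\rm Ca}=\omega_{\rm Ca}\}$ of $\mathrm{SO}(8)$ stabilizing the Cayley form $\omega_{\rm Ca}\in\Lambda^4(\mathbb R^8)$ is isomorphic to $\mathrm{Spin}(7)$.
   Context: $\mathbb R^8$ carries its standard Euclidean inner product and orientation; $e_1,\dots,e_8$ is the basis of the dual space which is dual to the standard orthonormal basis. $\mathrm{SO}(8)$ acts on $4$-forms by the natural action. For distinct indices write $e^{jklm}:=e_j\wedge e_k\wedge e_l\wedge e_m+{*}(e_j\wedge e_k\wedge e_l\wedge e_m)$, where $*$ is the Hodge star. The Cayley form is $$\omega_{\rm Ca}=e^{1234}+e^{1256}+e^{1278}+e^{1357}-e^{1368}-e^{1458}-e^{1467}.$$ $\mathrm{Spin}(7)$ is the compact real spin group, the double cover of $\mathrm{SO}(7)$. *)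

(* Defs.v *)
From HB Require Import structures.
From mathcomp Require Import all_boot all_order all_algebra.
From mathcomp Require Import all_classical all_reals all_analysis.
From mathcomp Require Import ring.

Set Implicit Arguments.
Unset Strict Implicit.
Unset Printing Implicit Defensive.
Import Order.TTheory GRing.Theory Num.Theory.
Import numFieldNormedType.Exports.
Local Open Scope classical_set_scope.
Local Open Scope ring_scope.

(* A k-form on R^n is a function of k column vectors, given as the columns of
   an n x k matrix. *)
Definition form (R : realType) (k n : nat) := 'M[R]_(n, k) -> R.

Definition alternating (R : realType) (k n : nat) (a : form R k n) : Prop :=
  (forall (V W1 W2 : 'M[R]_(n, k)) (j : 'I_k) (b c : R),
     col j V = b *: col j W1 + c *: col j W2 ->
     col' j W1 = col' j V -> col' j W2 = col' j V ->
     a V = b * a W1 + c * a W2) /\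
  (forall (V : 'M[R]_(n, k)) (i j : 'I_k),
     i != j -> col i V = col j V -> a V = 0).

(* The exterior product of k covectors, given as the rows of A; its value on
   v_1, ..., v_k is the determinant of the matrix of pairings (A_i, v_j). *)
Definition wedge (R : realType) (k n : nat) (A : 'M[R]_(k, n)) : form R k n :=
  fun V => \det (A *m V).

(* *a = \sum_J a(v_J) *(e_J) over increasing multi-indices J, where v_J is the
   corresponding family of standard basis vectors, and
   *(e_J)(W) = \det (v_J, W), the standard orientation being given by \det. *)
Definition hodge (R : realType) (k l : nat) (a : form R k (k + l)) :
    form R l (k + l) :=
  fun W => \sum_(J : {ffun 'I_k -> 'I_(k + l)} |
                 [forall i : 'I_k, forall j : 'I_k, (i < j)%N ==> (J i < J j)%N])
    a (colsub J 1%:M) * \det (row_mx (colsub J 1%:M) W).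

Definition form_act (R : realType) (k n : nat) (g : 'M[R]_n) (a : form R k n) :
    form R k n :=
  fun V => a (invmx g *m V).

(* The dual basis of R^8, numbered from 1 to 8. *)
Definition covec (R : realType) (j : nat) : 'rV[R]_8 :=
  \row_(i < 8) (i.+1 == j)%:R.

Definition wedge4 (R : realType) (j k l m : nat) : form R 4 8 :=
  wedge (\matrix_(i < 4)
    nth 0 [:: covec R j; covec R k; covec R l; covec R m] i).

Definition self_dual4 (R : realType) (j k l m : nat) : form R 4 8 :=
  wedge4 j k l m \+ @hodge _ 4 4 (wedge4 j k l m).

Definition cayley_form (R : realType) : form R 4 8 :=
  self_dual4 1 2 3 4 \+ self_dual4 1 2 5 6 \+ self_dual4 1 2 7 8
  \+ self_dual4 1 3 5 7 \- self_dual4 1 3 6 8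
  \- self_dual4 1 4 5 8 \- self_dual4 1 4 6 7.
Arguments cayley_form : clear implicits.

Section FormFacts.
Variable R : realType.

Lemma alternatingD k n (a b : form R k n) :
  alternating a -> alternating b -> alternating (a \+ b).
Proof.
move=> [aL aA] [bL bA]; split=> [V W1 W2 j x y e e1 e2 | V i j ij e] /=.
  by rewrite (aL _ _ _ _ _ _ e e1 e2) (bL _ _ _ _ _ _ e e1 e2) !mulrDr addrACA.
by rewrite (aA _ _ _ ij e) (bA _ _ _ ij e) addr0.
Qed.

Lemma alternatingB k n (a b : form R k n) :
  alternating a -> alternating b -> alternating (a \- b).
Proof.
move=> [aL aA] [bL bA]; split=> [V W1 W2 j x y e e1 e2 | V i j ij e] /=.
  by rewrite (aL _ _ _ _ _ _ e e1 e2) (bL _ _ _ _ _ _ e e1 e2) !mulrBr opprD addrACA.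
by rewrite (aA _ _ _ ij e) (bA _ _ _ ij e) subr0.
Qed.

Lemma alternating_wedge k n (A : 'M[R]_(k, n)) : alternating (wedge A).
Proof.
have rowE i (W : 'M[R]_(n, k)) : row i (W^T *m A^T) = (col i W)^T *m A^T.
  by rewrite row_mul -tr_col.
have row'E i (W : 'M[R]_(n, k)) : row' i (W^T *m A^T) = (col' i W)^T *m A^T.
  by apply/matrixP => p q; rewrite !mxE; apply: eq_bigr => s _; rewrite !mxE.
have detE (W : 'M[R]_(n, k)) : wedge A W = \det (W^T *m A^T).
  by rewrite /wedge -trmx_mul det_tr.
split=> [V W1 W2 j b c e e1 e2 | V i j ij e]; rewrite !detE.
  apply: (@determinant_multilinear _ _ _ _ _ j); rewrite ?rowE ?row'E ?e1 ?e2 //.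
  by rewrite e !linearD/= !linearZ/= mulmxDl -!scalemxAl.
apply: (determinant_alternate ij) => m.
have := congr1 (fun X : 'cV_n => (X^T *m A^T) 0 m) e.
by rewrite -!rowE !mxE.
Qed.

Lemma alternating_hodge k l (a : form R k (k + l)) : alternating (hodge a).
Proof.
pose B (J : {ffun 'I_k -> 'I_(k + l)}) : 'M[R]_(k + l, k) := colsub J 1%:M.
have colB J (W : 'M[R]_(k + l, l)) j :
  row (rshift k j) (row_mx (B J) W)^T = (col j W)^T.
  by apply/rowP => i; rewrite !mxE (unsplitK (inr _)).
split=> [V W1 W2 j b c e e1 e2 | V i j ij e].
  rewrite /hodge !mulr_sumr -big_split; apply: eq_bigr => J _ /=.
  rewrite !(mulrCA _ (a _)) -mulrDr; congr (_ * _).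
  rewrite -!(det_tr (row_mx _ _)) -/(B J).
  have row'B (W : 'M[R]_(k + l, l)) : col' j W = col' j V ->
      row' (rshift k j) (row_mx (B J) W)^T = row' (rshift k j) (row_mx (B J) V)^T.
    move=> eW; apply/matrixP => p q; rewrite !mxE.
    case: split_ordP => // p' ep; have /unlift_some[m -> _] : j != p'.
      by apply: contraTneq (neq_lift (rshift k j) p) => ejp; rewrite ep ejp eqxx.
    by have := congr1 (fun X : 'M[R]_(_, _) => X q m) eW; rewrite !mxE.
  apply: (@determinant_multilinear _ _ _ _ _ (rshift k j)).
  - by rewrite !colB e !linearD/= !linearZ.
  - exact: row'B.
  - exact: row'B.
rewrite /hodge big1 // => J _; rewrite -/(B J) -det_tr.
rewrite (@determinant_alternate _ _ _ (rshift k i) (rshift k j)) ?mulr0//.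
  by rewrite (inj_eq (@rshift_inj _ _)).
move=> m; have := congr1 (fun X : 'cV_(k + l) => X^T 0 m) e.
by rewrite -!(colB J) !mxE.
Qed.

Lemma alternating_cayley : alternating (cayley_form R).
Proof.
have sd j k l m : alternating (self_dual4 (R := R) j k l m).
  by apply: alternatingD; [|apply: (@alternating_hodge 4 4)];
    exact: alternating_wedge.
do 3![apply: alternatingB; last exact: sd].
by do 3![apply: alternatingD; last exact: sd]; exact: sd.
Qed.

End FormFacts.

Definition SO_set (R : realType) (n : nat) : set 'M[R]_n :=
  [set g | g^T *m g = 1%:M /\ \det g = 1].
Arguments SO_set : clear implicits.

Definition SO (R : realType) (n : nat) : Type := SO_set R n.
HB.instance Definition _ R n := SubType.copy (SO R n) (SO_set R n : Type).
HB.instance Definition _ R n := Choice.copy (SO R n) (SO_set R n : Type).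
HB.instance Definition _ R n := Topological.copy (SO R n) (SO_set R n : Type).

Section SOGroup.
Variables (R : realType) (n : nat).

Lemma SO_P (g : SO R n) : (val g)^T *m val g = 1%:M /\ \det (val g) = 1.
Proof. exact: set_mem (valP g). Qed.

Fact SO_one_subproof : (1%:M : 'M[R]_n) \in SO_set R n.
Proof. by apply/mem_set; rewrite /SO_set/= trmx1 mulmx1 det1. Qed.

Fact SO_inv_subproof (g : SO R n) : (val g)^T \in SO_set R n.
Proof.
have [/mulmx1C gg dg] := SO_P g.
by apply/mem_set; rewrite /SO_set/= trmxK det_tr.
Qed.

Fact SO_mul_subproof (g h : SO R n) : val g *m val h \in SO_set R n.
Proof.
have [gg dg] := SO_P g; have [hh dh] := SO_P h.
apply/mem_set; rewrite /SO_set/= trmx_mul mulmxA -(mulmxA _ _ (val g)) gg.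
by rewrite mulmx1 hh det_mulmx dg dh mulr1.
Qed.

Definition SO_one : SO R n := Sub 1%:M SO_one_subproof.
Definition SO_inv (g : SO R n) : SO R n := Sub (val g)^T (SO_inv_subproof g).
Definition SO_mul (g h : SO R n) : SO R n := 
  Sub (val g *m val h) (SO_mul_subproof g h).

Fact SO_mulA : associative SO_mul.
Proof. by move=> g h k; apply/val_inj; exact: mulmxA. Qed.
Fact SO_mul1g : left_id SO_one SO_mul.
Proof. by move=> g; apply/val_inj; exact: mul1mx. Qed.
Fact SO_mulg1 : right_id SO_one SO_mul.
Proof. by move=> g; apply/val_inj; exact: mulmx1. Qed.
Fact SO_mulVg : left_inverse SO_one SO_inv SO_mul.
Proof. by move=> g; apply/val_inj; exact: (SO_P g).1. Qed.
Fact SO_mulgV : right_inverse SO_one SO_inv SO_mul.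
Proof. by move=> g; apply/val_inj; exact: mulmx1C (SO_P g).1. Qed.

HB.instance Definition _ := isGroup.Build (SO R n)
  SO_mulA SO_mul1g SO_mulg1 SO_mulVg SO_mulgV.

End SOGroup.

Definition cayley_stabilizer_set (R : realType) : set (SO R 8) :=
  [set g | form_act (val g) (cayley_form R) = cayley_form R].
Arguments cayley_stabilizer_set : clear implicits.

Definition cayley_stabilizer (R : realType) : Type := cayley_stabilizer_set R.
HB.instance Definition _ R :=
  SubType.copy (cayley_stabilizer R) (cayley_stabilizer_set R : Type).
HB.instance Definition _ R :=
  Choice.copy (cayley_stabilizer R) (cayley_stabilizer_set R : Type).
HB.instance Definition _ R :=
  Topological.copy (cayley_stabilizer R) (cayley_stabilizer_set R : Type).

Lemma form_act1 (R : realType) k n (a : form R k n) : form_act 1%:M a = a.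
Proof. by apply/funext => V; rewrite /form_act invmx1 mul1mx. Qed.

Lemma form_actM (R : realType) k n (g h : 'M[R]_n) (a : form R k n) :
  g \in unitmx -> h \in unitmx ->
  form_act (g *m h) a = form_act g (form_act h a).
Proof.
move=> ug uh; apply/funext => V; rewrite /form_act mulmxA; congr (a (_ *m _)).
have e : (invmx h *m invmx g) *m (g *m h) = 1%:M.
  by rewrite mulmxA -(mulmxA _ _ g) mulVmx// mulmx1 mulVmx.
by rewrite -[LHS]mul1mx -e -mulmxA mulmxV ?mulmx1// unitmx_mul ug uh.
Qed.

Fact cayley_stabilizer_group_closed (R : realType) :
  group_closed (fun g : SO R 8 => g \in cayley_stabilizer_set R).
Proof.
have unitSO (g : SO R 8) : val g \in unitmx.
  by rewrite unitmxE (SO_P g).2 unitr1.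
split=> [|g h]; first by apply/mem_set; exact: form_act1.
move=> /set_mem gw /set_mem hw; apply/mem_set.
have {}gw : form_act (val g) (cayley_form R) = cayley_form R := gw.
have {}hw : form_act (val h) (cayley_form R) = cayley_form R := hw.
change (form_act (val g *m (val h)^T) (cayley_form R) = cayley_form R).
have hTw : form_act (val h)^T (cayley_form R) = cayley_form R.
  by rewrite -{1}hw -form_actM ?unitmx_tr// (SO_P h).1 form_act1.
by rewrite form_actM ?unitmx_tr// hTw gw.
Qed.

HB.instance Definition _ R :=
  SubChoice_isSubGroup.Build (SO R 8) _ (cayley_stabilizer R)
    (cayley_stabilizer_group_closed R).

Section Clifford.
Variables (R : realType) (n : nat).
Implicit Types S T U : {set 'I_n}.

Definition symdiff S T : {set 'I_n} := [set i | (i \in S) (+) (i \in T)].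

Definition cliff_sign S T : R :=
  \prod_(i in S) \prod_(j in T) (-1) ^+ (j <= i)%N.

(* The Clifford algebra generated by e_0, ..., e_(n-1) with e_i^2 = -1 and
   e_i e_j = - e_j e_i; an element x is \sum_S x(S) e_S, where e_S is the
   product of the e_i, i in S, in increasing order.  Thus
   e_S e_T = (-1)^k e_(symdiff S T), where k counts the pairs (i, j) in S x T
   with j < i (transpositions) or j = i (squares). *)
Definition clifford : Type := {ffun {set 'I_n} -> R}.

HB.instance Definition _ := GRing.Lmodule.copy clifford {ffun {set 'I_n} -> R}.

Definition cliff_basis S : clifford := [ffun T => (T == S)%:R].

Definition cliff_mul (x y : clifford) : clifford :=
  [ffun U => \sum_S \sum_(T | symdiff S T == U) cliff_sign S T * x S * y T].

Lemma symdiffA : associative symdiff.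
Proof. by move=> S T U; apply/setP => i; rewrite !inE addbA. Qed.

Lemma symdiffC : commutative symdiff.
Proof. by move=> S T; apply/setP => i; rewrite !inE addbC. Qed.

Lemma symdiff0 S : symdiff S finset.set0 = S.
Proof. by apply/setP => i; rewrite !inE addbF. Qed.

Lemma symdiffv S : symdiff S S = finset.set0.
Proof. by apply/setP => i; rewrite !inE addbb. Qed.

Lemma symdiffK S : involutive (symdiff S).
Proof. by move=> T; rewrite symdiffA symdiffv symdiffC symdiff0. Qed.

Lemma prod_symdiff (f : 'I_n -> R) S T : (forall i, f i * f i = 1) ->
  \prod_(i in symdiff S T) f i = (\prod_(i in S) f i) * \prod_(i in T) f i.
Proof.
move=> ff; rewrite !(big_mkcond (fun i => i \in _)) -big_split.
apply: eq_bigr => i _ /=; rewrite inE.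
by case: (i \in S); case: (i \in T); rewrite /= ?mulr1 ?mul1r ?ff.
Qed.

Lemma cliff_signDl S T U :
  cliff_sign (symdiff S T) U = cliff_sign S U * cliff_sign T U.
Proof.
apply: prod_symdiff => i; rewrite -big_split big1 //= => j _.
by rewrite -expr2 sqrr_sign.
Qed.

Lemma cliff_signDr S T U :
  cliff_sign S (symdiff T U) = cliff_sign S T * cliff_sign S U.
Proof.
rewrite /cliff_sign -big_split; apply: eq_bigr => i _.
by apply: prod_symdiff => j; rewrite -expr2 sqrr_sign.
Qed.

Lemma cliff_sign0l T : cliff_sign finset.set0 T = 1.
Proof. by rewrite /cliff_sign big_set0. Qed.

Lemma cliff_sign0r S : cliff_sign S finset.set0 = 1.
Proof. by rewrite /cliff_sign big1// => i _; rewrite big_set0. Qed.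

Lemma cliff_mulE (x y : clifford) U :
  cliff_mul x y U =
  \sum_S cliff_sign S (symdiff S U) * x S * y (symdiff S U).
Proof.
rewrite ffunE; apply: eq_bigr => S _.
by rewrite (big_pred1 (symdiff S U)) // => T /=; rewrite (inv_eq (symdiffK S)).
Qed.

Fact cliff_mulA : associative cliff_mul.
Proof.
move=> x y z; apply/ffunP => U; rewrite !cliff_mulE.
under eq_bigr do rewrite cliff_mulE mulr_sumr.
under [RHS]eq_bigr do rewrite cliff_mulE mulr_sumr mulr_suml.
rewrite [RHS]exchange_big; apply: eq_bigr => S _ /=.
rewrite [RHS](reindex_inj (can_inj (symdiffK S))); apply: eq_bigr => T _ /=.
set V := symdiff (symdiff S T) U.
have -> : symdiff S U = symdiff T V.
  by rewrite /V (symdiffC S T) -symdiffA symdiffK.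
rewrite !symdiffK cliff_signDr cliff_signDl; ring.
Qed.

Fact cliff_mul1x : left_id (cliff_basis finset.set0) cliff_mul.
Proof.
move=> x; apply/ffunP => U; rewrite cliff_mulE (bigD1 finset.set0)//= big1 => [|S].
  by rewrite ffunE eqxx symdiffC symdiff0 cliff_sign0l !mul1r addr0.
by rewrite ffunE => /negbTE->; rewrite mulr0 mul0r.
Qed.

Fact cliff_mulx1 : right_id (cliff_basis finset.set0) cliff_mul.
Proof.
move=> x; apply/ffunP => U; rewrite cliff_mulE (bigD1 U)//= big1 => [|S SU].
  by rewrite symdiffv ffunE eqxx cliff_sign0r mul1r mulr1 addr0.
rewrite ffunE (_ : _ == _ = false) ?mulr0//; apply: contraNF SU => /eqP e.
by rewrite -[U](symdiffK S) e symdiff0.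
Qed.

Fact cliff_mulDl : left_distributive cliff_mul +%R.
Proof.
move=> x y z; apply/ffunP => U; rewrite [RHS]ffunE !cliff_mulE -big_split.
by apply: eq_bigr => S _; rewrite ffunE mulrDr mulrDl.
Qed.

Fact cliff_mulDr : right_distributive cliff_mul +%R.
Proof.
move=> x y z; apply/ffunP => U; rewrite [RHS]ffunE !cliff_mulE -big_split.
by apply: eq_bigr => S _; rewrite ffunE mulrDr.
Qed.

Fact cliff_1_neq0 : cliff_basis finset.set0 != 0.
Proof.
apply/eqP => /ffunP/(_ finset.set0); rewrite !ffunE eqxx => /eqP.
by rewrite oner_eq0.
Qed.

HB.instance Definition _ := GRing.Zmodule_isNzRing.Build clifford
  cliff_mulA cliff_mul1x cliff_mulx1 cliff_mulDl cliff_mulDr cliff_1_neq0.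

Fact cliff_scaleAl (a : R) (x y : clifford) : a *: (x * y) = (a *: x) * y.
Proof.
apply/ffunP => U; rewrite [LHS]ffunE !cliff_mulE scaler_sumr; apply: eq_bigr => S _.
by rewrite ffunE /GRing.scale/=; ring.
Qed.

Fact cliff_scaleAr (a : R) (x y : clifford) : a *: (x * y) = x * (a *: y).
Proof.
apply/ffunP => U; rewrite [LHS]ffunE !cliff_mulE scaler_sumr; apply: eq_bigr => S _.
by rewrite ffunE /GRing.scale/=; ring.
Qed.

HB.instance Definition _ :=
  GRing.Lmodule_isLalgebra.Build R clifford cliff_scaleAl.
HB.instance Definition _ :=
  GRing.Lalgebra_isAlgebra.Build R clifford cliff_scaleAr.

HB.instance Definition _ := Topological.copy clifford
  (initial_topology (fun (x : clifford) =>
     (fun S => x S) : prod_topology (fun _ : {set 'I_n} => R))).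

Definition cliff_vec (v : 'rV[R]_n) : clifford :=
  \sum_i v 0 i *: cliff_basis [set i].

Lemma cliff_basisM S T :
  cliff_basis S * cliff_basis T = cliff_sign S T *: cliff_basis (symdiff S T).
Proof.
apply/ffunP => U; rewrite [LHS]cliff_mulE (bigD1 S)//= big1 => [|S' /negbTE S'S].
  rewrite !ffunE eqxx mulr1 addr0 /GRing.scale/= (inv_eq (symdiffK S)).
  by case: eqP => [->|]; rewrite ?symdiffK ?mulr0.
by rewrite ffunE S'S mulr0 mul0r.
Qed.

Lemma cliff_vec_sq (v : 'rV[R]_n) :
  cliff_vec v * cliff_vec v = - (\sum_i v 0 i ^+ 2)%:A.
Proof.
pose f i j := (v 0 i * v 0 j) *: (cliff_basis [set i] * cliff_basis [set j]).
have vvE : cliff_vec v * cliff_vec v = \sum_i \sum_j f i j.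
  rewrite /cliff_vec mulr_suml; apply: eq_bigr => i _.
  rewrite mulr_sumr; apply: eq_bigr => j _.
  by rewrite -scalerAl -scalerAr scalerA.
have sgE i j : cliff_sign [set i] [set j] = (-1) ^+ (j <= i)%N.
  by rewrite /cliff_sign !big_set1.
have fE i j : f i j + f j i = - (((i == j)%:R * v 0 i ^+ 2 * 2%:R) *: 1).
  rewrite /f !cliff_basisM !sgE (symdiffC (finset.set1 j) (finset.set1 i)) (mulrC (v 0 j)) -scalerDr.
  rewrite -scalerDl scalerA; case: eqVneq => [<-|ij].
    by rewrite symdiffv leqnn -scaleNr; congr (_ *: _); rewrite /= expr1; ring.
  suff -> : (-1) ^+ (j <= i)%N + (-1) ^+ (i <= j)%N = 0 :> R.
    by rewrite mulr0 !mul0r !scale0r oppr0.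
  by case: (ltngtP i j) ij => [||/val_inj->]; rewrite ?eqxx//= => _ _; ring.
have two : (2%:R : R) != 0 by rewrite pnatr_eq0.
apply: (scalerI two); rewrite vvE scaler_nat mulr2n {2}exchange_big -big_split/=.
under eq_bigr => i _.
  rewrite -big_split (bigD1 i)//= big1 => [|j /negbTE ji]; last first.
    by rewrite fE eq_sym ji !mul0r scale0r oppr0.
  rewrite fE eqxx mul1r addr0; over.
by rewrite sumrN -scaler_suml -mulr_suml scalerN scalerA [2 * _]mulrC.
Qed.

Definition Spin_set : set clifford :=
  [set x | exists s : seq 'rV[R]_n,
     [/\ forall v, v \in s -> \sum_i v 0 i ^+ 2 = 1,
         ~~ odd (size s)
       & x = \prod_(v <- s) cliff_vec v]].

Definition Spin : Type := Spin_set.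
HB.instance Definition _ := SubType.copy Spin (Spin_set : Type).
HB.instance Definition _ := Choice.copy Spin (Spin_set : Type).
HB.instance Definition _ := Topological.copy Spin (Spin_set : Type).

Lemma prod_cliff_vec_rev (s : seq 'rV[R]_n) :
  (forall v, v \in s -> \sum_i v 0 i ^+ 2 = 1) ->
  (\prod_(v <- s) cliff_vec v) * (\prod_(v <- rev s) cliff_vec v) =
  (-1) ^+ size s.
Proof.
elim: s => [|v s IHs] us; first by rewrite !big_nil mulr1.
rewrite rev_cons -cats1 big_cat !big_cons big_nil /= mulr1 -mulrA.
rewrite (mulrA (\prod_(j <- s) _)) IHs => [|w ws]; last first.
  by apply: us; rewrite inE ws orbT.
rewrite mulrA (commr_sign (cliff_vec v)) -mulrA cliff_vec_sq us ?mem_head//.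
by rewrite scale1r exprSr.
Qed.

Lemma Spin_set1 : Spin_set 1.
Proof. by exists [::]; rewrite big_nil. Qed.

Lemma Spin_setM (x y : clifford) : Spin_set x -> Spin_set y -> Spin_set (x * y).
Proof.
move=> [s [us es ->]] [t [ut et ->]]; exists (s ++ t); rewrite big_cat; split=> //.
  by move=> v; rewrite mem_cat => /orP[/us|/ut].
by rewrite size_cat oddD (negbTE es) (negbTE et).
Qed.

Lemma Spin_setV (x : clifford) : Spin_set x ->
  exists y, [/\ Spin_set y, x * y = 1 & y * x = 1].
Proof.
move=> [s [us es ->]]; exists (\prod_(v <- rev s) cliff_vec v).
have sgn1 : (-1) ^+ size s = 1 :> clifford by rewrite -signr_odd (negbTE es).
split; last 2 first.
- by rewrite prod_cliff_vec_rev.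
- rewrite -{2}(revK s) prod_cliff_vec_rev ?size_rev// => v.
  by rewrite mem_rev => /us.
exists (rev s); rewrite size_rev; split=> // v.
by rewrite mem_rev => /us.
Qed.

Lemma SpinP (x : Spin) : Spin_set (val x).
Proof. exact: set_mem (valP x). Qed.

Definition Spin_one : Spin := Sub (1 : clifford) (mem_set Spin_set1).
Definition Spin_mul (x y : Spin) : Spin :=
  Sub (val x * val y) (mem_set (Spin_setM (SpinP x) (SpinP y))).
Definition Spin_inv (x : Spin) : Spin :=
  let: exist y yP := cid (Spin_setV (SpinP x)) in
  let: And3 Sy _ _ := yP in Sub y (mem_set Sy).

Fact Spin_mulA : associative Spin_mul.
Proof. by move=> x y z; apply/val_inj; exact: mulrA. Qed.
Fact Spin_mul1g : left_id Spin_one Spin_mul.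
Proof. by move=> x; apply/val_inj; exact: mul1r. Qed.
Fact Spin_mulg1 : right_id Spin_one Spin_mul.
Proof. by move=> x; apply/val_inj; exact: mulr1. Qed.
Fact Spin_mulVg : left_inverse Spin_one Spin_inv Spin_mul.
Proof. by move=> x; apply/val_inj; rewrite /Spin_inv; case: cid => y []. Qed.
Fact Spin_mulgV : right_inverse Spin_one Spin_inv Spin_mul.
Proof. by move=> x; apply/val_inj; rewrite /Spin_inv; case: cid => y []. Qed.

HB.instance Definition _ := isGroup.Build Spin
  Spin_mulA Spin_mul1g Spin_mulg1 Spin_mulVg Spin_mulgV.

End Clifford.

Arguments Spin_set : clear implicits.

(* Main.v *)
From HB Require Import structures.
Require Import Defs.
From mathcomp Require Import all_boot all_order all_algebra.
From mathcomp Require Import all_classical all_reals all_analysis.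
From mathcomp Require Import ring lra zify.

(* The real spin representation sends the generators of the Clifford algebra of
   R^7 to skew signed permutation matrices gamma_1, ..., gamma_7 of size 8, with
   gamma_1 ... gamma_7 = -1.  Everything rests on the identity
     3 cayley(v1, ..., v4) = sum_i B_i(v1, v2) B_i(v3, v4)
       - B_i(v1, v3) B_i(v2, v4) + B_i(v1, v4) B_i(v2, v3),
   B_i being the bilinear form of gamma_i: the right-hand side depends only on
   the span E of the gamma_i with its Euclidean structure.  For a unit vector u,
   conjugation by gamma_u is minus a reflection of E, so gamma_u fixes the Cayley
   form.  Conversely let g fix it and put X = g^T gamma_j g.  Contracting the
   identity with X yields 18 X = 8 P + 2 sum_i gamma_i X gamma_i, where P is the
   projection of X on E; as sum_i gamma_i P gamma_i = 5 P, the matrix Y = X - P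
   satisfies sum_i gamma_i Y gamma_i = 9 Y, which forces Y = 0 because the seven
   terms on the left have the norm of Y.  So g normalizes E, and by
   Cartan-Dieudonne it agrees with a product of gamma_u's up to an element h
   commuting or anticommuting with all gamma_i.  Anticommutation is excluded by
   gamma_1 ... gamma_7 = -1, and h commuting with all gamma_i is a scalar, hence
   1 or -1.  Finally, the monomials of even degree in the gamma_i are orthogonal
   for the trace form, so the inverse isomorphism is given by traces and both
   maps are continuous. *)

Set Implicit Arguments.
Unset Strict Implicit.
Unset Printing Implicit Defensive.
Import Order.TTheory GRing.Theory Num.Theory.
Import numFieldNormedType.Exports.
Local Open Scope ring_scope.

(** * Representations of the Clifford algebra by anticommuting square roots of -1 *)

Section CliffordModule.
Variables (R : realType) (n : nat) (A : algType R) (g : 'I_n -> A).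

Definition cliff_monom (S : {set 'I_n}) : A := \prod_(i <- enum 'I_n | i \in S) g i.

Definition cliff_rep (x : clifford R n) : A := \sum_S x S *: cliff_monom S.

Fact cliff_rep_is_linear : linear cliff_rep.
Proof.
move=> a x y; rewrite /cliff_rep scaler_sumr -big_split; apply: eq_bigr => S _ /=.
by rewrite !ffunE scalerDl scalerA.
Qed.

HB.instance Definition _ :=
  GRing.isLinear.Build R (clifford R n) A _ cliff_rep cliff_rep_is_linear.

Lemma cliff_rep_basis S : cliff_rep (cliff_basis R S) = cliff_monom S.
Proof.
rewrite /cliff_rep (bigD1 S)//= big1 => [|T /negbTE TS]; rewrite ffunE.
  by rewrite eqxx scale1r addr0.
by rewrite TS scale0r.
Qed.

Lemma cliff_rep1 : cliff_rep 1 = 1.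
Proof. by rewrite cliff_rep_basis /cliff_monom big1// => i; rewrite inE. Qed.

Lemma cliff_sum_basis (x : clifford R n) : x = \sum_S x S *: cliff_basis R S.
Proof.
apply/ffunP => T; rewrite sum_ffunE (bigD1 T)//= big1 => [|S /negbTE TS].
  by rewrite !ffunE eqxx /GRing.scale/= mulr1 addr0.
by rewrite !ffunE eq_sym TS /GRing.scale/= mulr0.
Qed.

Lemma prod_in_enum (F : 'I_n -> R) (T : {set 'I_n}) :
  \prod_(j in T) F j = \prod_(j <- enum 'I_n | j \in T) F j.
Proof. by rewrite big_enum_cond. Qed.

Hypothesis g_sq : forall i, g i * g i = -1.
Hypothesis g_anti : forall i j, i != j -> g i * g j = - (g j * g i).

(** Moving [g i] to its place passes the factors [g j] with j < i, each costing a sign, and a factor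
    [g i] already present costs the sign of its square; [cliff_sign] counts exactly these j <= i. *)
Lemma cliff_monom_mull i T :
  g i * cliff_monom T =
  cliff_sign R [set i] T *: cliff_monom (symdiff [set i] T).
Proof.
rewrite /cliff_sign big_set1 /cliff_monom.
rewrite prod_in_enum.
have : i \in enum 'I_n by rewrite mem_enum.
have : sorted (relpre val ltn) (enum 'I_n).
  by rewrite -sorted_map val_enum_ord iota_ltn_sorted.
elim: (enum 'I_n) => // j s IHs; rewrite /= path_sortedE; last first.
  by move=> x y z /=; exact: ltn_trans.
move=> /andP[/allP js s_sorted]; rewrite inE => /predU1P[ij | i_s].
  subst j; rewrite !big_cons !inE eqxx.
  (* Past i only larger indices remain, and they contribute no sign. *)
  have -> : \prod_(j <- s | j \in T) (-1) ^+ (j <= i)%N = 1 :> R.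
    by rewrite big_seq_cond big1// => j /andP[/js /= ij _]; rewrite leqNgt ij.
  have -> : \prod_(j <- s | j \in symdiff [set i] T) g j =
            \prod_(j <- s | j \in T) g j.
    rewrite big_seq_cond [RHS]big_seq_cond; apply: eq_bigl => j.
    case: (boolP (j \in s)) => //= /js /= ij; rewrite !inE.
    by rewrite -(inj_eq val_inj) gtn_eqF.
  case: (i \in T) => /=; last by rewrite scale1r.
  by rewrite mulrA g_sq leqnn expr1 mulr1 scaleN1r mulN1r.
have ji : (j < i)%N := js _ i_s.
have jNi : i != j by rewrite -(inj_eq val_inj) gtn_eqF.
rewrite !big_cons !inE eq_sym (negbTE jNi) (ltnW ji) /= expr1.
case: ifP => _; last exact: IHs.
by rewrite mulrA g_anti// mulNr -mulrA IHs// -scalerAr -scaleN1r scalerA.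
Qed.

(** Elements of the spin group are products of vectors, so multiplicativity is established for a
    vector on the left and then iterated. *)
Lemma cliff_rep_vecM v x :
  cliff_rep (cliff_vec v * x) = (\sum_i v 0 i *: g i) * cliff_rep x.
Proof.
rewrite [in LHS](cliff_sum_basis x) /cliff_vec !mulr_suml linear_sum.
apply: eq_bigr => i _ /=; rewrite mulr_sumr linear_sum mulr_sumr.
apply: eq_bigr => S _ /=; rewrite -scalerAl -!scalerAr cliff_basisM.
by rewrite !linearZ/= cliff_rep_basis -cliff_monom_mull -scalerAl !scalerA mulrC.
Qed.

Lemma cliff_rep_prod_vec (s : seq 'rV[R]_n) :
  cliff_rep (\prod_(v <- s) cliff_vec v) =
  \prod_(v <- s) \sum_i v 0 i *: g i.
Proof.
elim: s => [|v s IHs]; first by rewrite !big_nil cliff_rep1.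
by rewrite !big_cons cliff_rep_vecM IHs.
Qed.

Lemma cliff_monom_comm i S :
  g i * cliff_monom S = (-1) ^+ #|S :\ i| *: (cliff_monom S * g i).
Proof.
have -> : (-1) ^+ #|S :\ i| = \prod_(j in S) (if j == i then 1 else -1) :> R.
  rewrite -prodr_const (eq_bigl (fun j => (j \in S) && (j != i))); last first.
    by move=> j; rewrite !inE andbC.
  by rewrite big_mkcondr; apply: eq_bigr => j _; rewrite if_neg.
rewrite prod_in_enum /cliff_monom.
elim: (enum 'I_n) => [|j s IHs]; first by rewrite !big_nil mulr1 mul1r scale1r.
rewrite !big_cons; case: ifP => // _; case: eqVneq => [->|ji].
  by rewrite mul1r -mulrA IHs -scalerAr.
rewrite mulrA g_anti 1?eq_sym// mulNr -(mulrA (g j) (g i)) IHs mulN1r scaleNr.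
by rewrite -scalerAr mulrA.
Qed.

End CliffordModule.

(* Signs of the 2-forms e_1 /\ e_(i+2) + (cayley form contracted with e_1 and
   e_(i+2)), for i = 0, ..., 6. *)
Definition gamma_neg (i a : nat) : bool :=
  a \in nth [::] [:: [:: 1; 3; 5; 7]; [:: 1; 2; 5; 6]; [:: 2; 3; 4; 5];
    [:: 1; 2; 4; 7]; [:: 4; 5; 6; 7]; [:: 1; 3; 4; 6]; [:: 2; 3; 6; 7]]%N i.

Definition gamma_col (i a : nat) : nat := Nat.lxor a i.+1.

(* Sign and column of the nonzero entry in row a of the product of the gamma i,
   i in s. *)
Fixpoint gamma_word (s : seq nat) (a : nat) : bool * nat :=
  if s is i :: s' then
    let: (e, c) := gamma_word s' (gamma_col i a) in (gamma_neg i a (+) e, c)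
  else (false, a).

(** * The seven gamma matrices: Clifford relations and commutant *)

Section Gamma.
Variable R : realType.

(* Row a of gamma i has its only nonzero entry in column a xor (i + 1), the
   indices of 'I_8 being read in binary. *)
Definition gamma (i : 'I_7) : 'M[R]_8 :=
  \matrix_(a, b) ((-1) ^+ gamma_neg i a *+ (b == gamma_col i a :> nat)).

Lemma gamma_col_lt (i : 'I_7) (a : 'I_8) : (gamma_col i a < 8)%N.
Proof.
have: all (fun i => all (fun a => gamma_col i a < 8)%N (iota 0 8)) (iota 0 7).
  by vm_compute.
by move=> /allP/(_ i); rewrite mem_iota ltn_ord => /(_ isT)/allP;
   apply; rewrite mem_iota ltn_ord.
Qed.

Lemma gamma_mulmx m i (X : 'M[R]_(8, m)) a b :
  (gamma i *m X) a b = (-1) ^+ gamma_neg i a * X (inord (gamma_col i a)) b.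
Proof.
rewrite mxE (bigD1 (inord (gamma_col i a)))//= big1 => [|c ci].
  by rewrite mxE inordK ?gamma_col_lt// eqxx mulr1n addr0.
rewrite mxE (_ : _ == _ = false) ?mulr0n ?mul0r//.
by apply: contraNF ci => /eqP <-; rewrite inord_val.
Qed.

Lemma gamma_mull i (X : 'M[R]_8) a b :
  (gamma i * X) a b = (-1) ^+ gamma_neg i a * X (inord (gamma_col i a)) b.
Proof. exact: gamma_mulmx. Qed.

Lemma gamma_prodE (s : seq 'I_7) (a b : 'I_8) :
  (\prod_(i <- s) gamma i) a b =
  (-1) ^+ (gamma_word (map val s) a).1 *+
    (b == (gamma_word (map val s) a).2 :> nat).
Proof.
elim: s a => [|i s IHs] a; first by rewrite big_nil mxE /= expr0 eq_sym.
rewrite big_cons gamma_mull IHs /= inordK ?gamma_col_lt//.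
by case: gamma_word => e c /=; rewrite mulrnAr signr_addb.
Qed.

(** Words in the gammas are signed permutation matrices, so an identity between two of them is a
    check of sign and column on the eight rows, which computation settles. *)
Lemma gamma_word_prod (s t : seq 'I_7) (e : bool) :
  all (fun a => gamma_word (map val s) a ==
         (let: (b, c) := gamma_word (map val t) a in (e (+) b, c))) (iota 0 8) ->
  \prod_(i <- s) gamma i = (-1) ^+ e * \prod_(i <- t) gamma i.
Proof.
move=> /allP st; apply/matrixP => a b; rewrite mulr_sign.
have := st a; rewrite mem_iota ltn_ord => /(_ isT)/eqP.
rewrite gamma_prodE => ->; case: e {st}; rewrite ?mxE gamma_prodE;
  by case: gamma_word => -[] c /=; rewrite ?mulNrn ?opprK.
Qed.

Lemma gamma_sq i : gamma i * gamma i = -1.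
Proof.
have := @gamma_word_prod [:: i; i] [::] true; rewrite !big_cons big_nil.
rewrite !mulr1 expr1; apply.
have: all (fun i => all (fun a => gamma_word [:: i; i] a == (true, a)) (iota 0 8))
   (iota 0 7) by vm_compute.
by move=> /allP; apply; rewrite mem_iota ltn_ord.
Qed.

Lemma gamma_anti i j : i != j -> gamma i * gamma j = - (gamma j * gamma i).
Proof.
move=> ij; have := @gamma_word_prod [:: i; j] [:: j; i] true.
rewrite !big_cons big_nil !mulr1 expr1 mulN1r; apply.
have: all (fun i => all (fun j => (i != j) ==> all (fun a =>
    gamma_word [:: i; j] a ==
    (let: (b, c) := gamma_word [:: j; i] a in (true (+) b, c)))
   (iota 0 8)) (iota 0 7)) (iota 0 7) by vm_compute.
move=> /allP/(_ i); rewrite mem_iota ltn_ord => /(_ isT)/allP/(_ j).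
by rewrite mem_iota ltn_ord => /(_ isT)/implyP; apply.
Qed.

Lemma gamma_tr i : (gamma i)^T = - gamma i.
Proof.
apply/matrixP => a b; rewrite !mxE.
have: all (fun i => all (fun a => all (fun b =>
    ((a == gamma_col i b) == (b == gamma_col i a)) &&
    ((b == gamma_col i a) ==> (gamma_neg i b == ~~ gamma_neg i a)))
   (iota 0 8)) (iota 0 8)) (iota 0 7) by vm_compute.
move=> /allP/(_ i); rewrite mem_iota ltn_ord => /(_ isT)/allP/(_ a).
rewrite mem_iota ltn_ord => /(_ isT)/allP/(_ b).
rewrite mem_iota ltn_ord => /(_ isT)/andP[/eqP-> /implyP].
case: eqP => [_ /(_ isT)/eqP->|]; last by rewrite !mulr0n oppr0.
by rewrite signrN mulNrn.
Qed.

Lemma gamma_prod : \prod_(i <- enum 'I_7) gamma i = -1.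
Proof.
have := @gamma_word_prod (enum 'I_7) [::] true.
by rewrite big_nil mulr1 expr1 val_enum_ord; apply; vm_compute.
Qed.

(** Certain words are diagonal sign matrices separating the coordinates, so commuting with them
    makes X diagonal; [gamma i] links index 0 to index i + 1, which makes the diagonal constant. *)
Lemma gamma_commutant (X : 'M[R]_8) :
  (forall i, X * gamma i = gamma i * X) -> X = (X 0 0)%:M.
Proof.
move=> Xg.
have XP s : X * \prod_(i <- s) gamma i = (\prod_(i <- s) gamma i) * X.
  elim: s => [|i s IHs]; first by rewrite big_nil mulr1 mul1r.
  by rewrite big_cons mulrA Xg -mulrA IHs mulrA.
have X0 a b : a != b -> X a b = 0.
  have diag (s : seq 'I_7) :
    all (fun a => (gamma_word (map val s) a).2 == a) (iota 0 8) ->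
    (gamma_word (map val s) a).1 != (gamma_word (map val s) b).1 -> X a b = 0.
    move=> /allP ds sab.
    have {}ds (c : 'I_8) : (gamma_word (map val s) c).2 = c.
      by apply/eqP/ds; rewrite mem_iota ltn_ord.
    move: (XP s) (gamma_prodE s); move: (\prod_(i <- s) gamma i) => P XPP PE.
    have := congr1 (fun Y : 'M[R]_8 => Y a b) XPP; rewrite /= mxE [RHS]mxE.
    rewrite (bigD1 b)//= big1 => [|c cb]; last first.
      by rewrite PE ds (inj_eq val_inj) eq_sym (negbTE cb) mulr0n mulr0.
    rewrite [RHS](bigD1 a)//= [in RHS]big1 => [|c ca]; last first.
      by rewrite PE ds (inj_eq val_inj) (negbTE ca) mulr0n mul0r.
    rewrite !PE !ds !eqxx !mulr1n !addr0.
    move: sab; do 2![case: (gamma_word _ _).1]; rewrite //= => _;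
      rewrite ?expr1 ?expr0; lra.
  move=> ab.
  (* Three words whose products are diagonal and separate the coordinates. *)
  have: all (fun a => all (fun b => (a != b) ==>
     has (fun s => (gamma_word s a).1 != (gamma_word s b).1)
        [:: [:: 0; 1; 2]; [:: 0; 3; 4]; [:: 1; 3; 5]]%N) (iota 0 8)) (iota 0 8).
    by vm_compute.
  move=> /allP/(_ a); rewrite mem_iota ltn_ord => /(_ isT)/allP/(_ b).
  rewrite mem_iota ltn_ord => /(_ isT)/implyP/(_ ab) /=.
  case/or4P => // [s|s|s].
  - by apply: (diag [:: inord 0; inord 1; inord 2]); rewrite /= ?inordK.
  - by apply: (diag [:: inord 0; inord 3; inord 4]); rewrite /= ?inordK.
  - by apply: (diag [:: inord 1; inord 3; inord 5]); rewrite /= ?inordK.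
apply/matrixP => a b; rewrite [RHS]mxE.
have [<-|/X0->] := eqVneq a b; last by rewrite mulr0n.
rewrite mulr1n; have [i ->|->] := unliftP 0 a => //.
have := congr1 (fun Y : 'M[R]_8 => Y 0 (lift 0 i)) (Xg i).
rewrite /= gamma_mull mxE (bigD1 0)//= big1 => [|c c0]; last first.
  by rewrite X0 1?eq_sym// mul0r.
(* Row 0 of [gamma i] has entry 1 in column i + 1, so comparing the entries there equates two
   diagonal entries of X. *)
have [ge gn] : gamma_col i 0%N = i.+1 /\ gamma_neg i 0%N = false.
  by case: i => -[|[|[|[|[|[|[|]]]]]]].
rewrite mxE ge gn eqxx mulr1n expr0 mulr1 addr0 mul1r => ->.
by congr (X _ _); apply/val_inj; rewrite /= inordK//; exact: (ltn_ord i).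
Qed.

End Gamma.

(** * The span of the gamma matrices as a Euclidean space *)

Section GammaVectors.
Variable R : realType.
Local Notation gamma := (@gamma R).
Implicit Types (u v : 'rV[R]_7) (X Y : 'M[R]_8).

Definition dot u v : R := \sum_i u 0 i * v 0 i.

Lemma dotC u v : dot u v = dot v u.
Proof. by apply: eq_bigr => i _; rewrite mulrC. Qed.

Lemma dotBl u v w : dot (u - v) w = dot u w - dot v w.
Proof. by rewrite /dot -sumrB; apply: eq_bigr => i _; rewrite !mxE mulrBl. Qed.

Lemma dotBr u v w : dot w (u - v) = dot w u - dot w v.
Proof. by rewrite !(dotC w) dotBl. Qed.

Lemma dotZl a u v : dot (a *: u) v = a * dot u v.
Proof. by rewrite /dot mulr_sumr; apply: eq_bigr => i _; rewrite mxE mulrA. Qed.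

Lemma dotZr a u v : dot u (a *: v) = a * dot u v.
Proof. by rewrite dotC dotZl dotC. Qed.

Lemma dot_delta u i : dot u (delta_mx 0 i) = u 0 i.
Proof.
rewrite /dot (bigD1 i)//= big1 => [|j ji]; rewrite mxE.
  by rewrite !eqxx mulr1 addr0.
by rewrite (negbTE ji) andbF mulr0.
Qed.

Lemma dot_ge0 u : 0 <= dot u u.
Proof. by apply: sumr_ge0 => i _; rewrite -expr2 sqr_ge0. Qed.

Lemma dot_eq0 u : (dot u u == 0) = (u == 0).
Proof.
apply/eqP/eqP => [|->]; last by rewrite /dot big1// => i _; rewrite mxE mul0r.
move=> /psumr_eq0P u0; apply/rowP => i; rewrite mxE.
have := u0 (fun i _ => _) i isT; rewrite -expr2 => h.
by apply/eqP; rewrite -sqrf_eq0 h// => j; rewrite -expr2 sqr_ge0.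
Qed.

Definition gam u : 'M[R]_8 := \sum_i u 0 i *: gamma i.

Fact gam_is_linear : linear gam.
Proof.
move=> a u v; rewrite /gam scaler_sumr -big_split; apply: eq_bigr => i _ /=.
by rewrite !mxE scalerDl scalerA.
Qed.

HB.instance Definition _ :=
  GRing.isLinear.Build R 'rV[R]_7 'M[R]_8 _ gam gam_is_linear.

Lemma gam_delta i : gam (delta_mx 0 i) = gamma i.
Proof.
rewrite /gam (bigD1 i)//= big1 => [|j ji]; rewrite mxE.
  by rewrite !eqxx scale1r addr0.
by rewrite (negbTE ji) andbF scale0r.
Qed.

Lemma gam_tr u : (gam u)^T = - gam u.
Proof.
rewrite /gam linear_sum -sumrN; apply: eq_bigr => i _.
by rewrite linearZ/= gamma_tr scalerN.
Qed.

Lemma gam_anti u v : gam u * gam v = - (gam v * gam u) - (2 * dot u v)%:A.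
Proof.
have gg i j : gamma i * gamma j = - (gamma j * gamma i) - (2 * (i == j)%:R)%:A.
  have [<-|ij] := eqVneq i j; last by rewrite gamma_anti// mulr0 scale0r subr0.
  rewrite gamma_sq mulr1 opprK scaler_nat mulr2n opprD addrA subrr sub0r.
  by [].
rewrite /gam mulr_suml.
under eq_bigr do rewrite mulr_sumr.
rewrite mulr_suml -sumrN.
under [X in _ = X - _]eq_bigr do rewrite mulr_sumr -sumrN.
rewrite [X in _ = X - _]exchange_big /= /dot mulr_sumr scaler_suml -sumrB.
apply: eq_bigr => i _.
have -> : (2 * (u 0 i * v 0 i))%:A =
   \sum_j (2 * (i == j)%:R * (u 0 i * v 0 j))%:A :> 'M[R]_8.
  rewrite (bigD1 i)//= big1 ?addr0 ?eqxx ?mulr1// => j; rewrite eq_sym => /negbTE->.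
  by rewrite mulr0 mul0r scale0r.
rewrite -sumrB; apply: eq_bigr => j _.
rewrite -!scalerAl -!scalerAr !scalerA gg scalerBr scalerN (mulrC (v 0 j)).
by rewrite scalerA; congr (_ - _ *: _); rewrite /GRing.scale /=; ring.
Qed.

Lemma gam_sq u : gam u * gam u = - (dot u u)%:A.
Proof.
have two : (2%:R : R) != 0 by rewrite pnatr_eq0.
apply: (scalerI two); rewrite scaler_nat mulr2n {1}gam_anti addrAC addNr add0r.
by rewrite scalerN scalerA.
Qed.

(** For unit [u] the result is [gam] of the reflection of [v] in the hyperplane orthogonal to
    [u]. *)
Lemma gam_sandwich u v :
  gam u * gam v * gam u = dot u u *: gam v - (2 * dot u v) *: gam u.
Proof.
rewrite gam_anti mulrBl mulNr -mulrA gam_sq mulrN opprK -scalerAl mul1r.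
by rewrite -scalerAr mulr1.
Qed.

Lemma mxtrace_mulr X Y : \tr (X * Y) = \tr (Y * X).
Proof. exact: mxtrace_mulC. Qed.

Lemma trmx_mulr X Y : (X * Y)^T = Y^T * X^T.
Proof. exact: trmx_mul. Qed.

Lemma mxtrace_gam u v : \tr (gam u * gam v) = - (8 * dot u v).
Proof.
have := congr1 mxtrace (gam_anti u v).
rewrite raddfB raddfN /= (mxtrace_mulr (gam v)) linearZ/= mxtrace1; lra.
Qed.

Lemma gam_orth u : dot u u = 1 -> (gam u)^T * gam u = 1.
Proof. by move=> u1; rewrite gam_tr mulNr gam_sq opprK u1 scale1r. Qed.

(* (1 + gam u)^2 = 2 gam u, so \det (gam u) is nonnegative. *)
Lemma det_gam u : dot u u = 1 -> \det (gam u) = 1.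
Proof.
move=> u1; have dd : \det (gam u) ^+ 2 = 1.
  by rewrite expr2 -{1}det_tr -det_mulmx [_ *m _]gam_orth// det1.
have : 0 <= \det (gam u).
  have e : (1 + gam u) * (1 + gam u) = 2 *: gam u.
    rewrite mulrDl mul1r mulrDr mulr1 gam_sq u1 scale1r.
    by rewrite addrC addrA subrK scaler_nat mulr2n.
  have := det_mulmx (1 + gam u) (1 + gam u).
  rewrite -[_ *m _]/((1 + gam u) * (1 + gam u)) e detZ -expr2 => h.
  by rewrite -(pmulr_rge0 _ (exprn_gt0 8 (ltr0n _ 2))) h sqr_ge0.
by move: (\det _) dd => d; move/eqP; rewrite sqrf_eq1 => /orP[]/eqP->//; lra.
Qed.

(** The pairing (ab)(cd) contracts with X to a trace, the pairings (ac)(bd) and (ad)(bc) to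
    sandwiches of X and of its transpose. *)
Lemma quartic_contract (F : 'I_7 -> 'M[R]_8) X a b :
  \sum_c \sum_d (\sum_i (F i a b * F i c d - F i a c * F i b d
                         + F i a d * F i b c)) * X c d =
  (\sum_i (\tr ((F i)^T * X) *: F i - F i * X * (F i)^T
           + F i * X^T * (F i)^T)) a b.
Proof.
under eq_bigr do under eq_bigr do rewrite mulr_suml.
under eq_bigr do rewrite exchange_big /=.
rewrite exchange_big summxE; apply: eq_bigr => i _ /=.
have trE : \tr ((F i)^T * X) = \sum_c \sum_d F i c d * X c d.
  rewrite exchange_big; apply: eq_bigr => d _; rewrite mxE.
  by apply: eq_bigr => c _; rewrite mxE.
have FXF Y : (F i * Y * (F i)^T) a b = \sum_c \sum_d F i a c * Y c d * F i b d.
  rewrite exchange_big mxE; apply: eq_bigr => d _; rewrite mxE mulr_suml.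
  by apply: eq_bigr => c _; rewrite !mxE.
have entry c (Y Z W : 'M[R]_8) :
  (c *: Y - Z + W) a b = c * Y a b - Z a b + W a b by rewrite !mxE.
rewrite entry !FXF trE mulr_suml [X in _ + X]exchange_big -sumrB -big_split /=.
apply: eq_bigr => c _; rewrite mulr_suml -sumrB -big_split /=.
by apply: eq_bigr => d _; rewrite mxE; ring.
Qed.

Lemma gamma_span (g : 'M[R]_8) : g^T * g = 1 ->
  (forall a b c d,
    let F i := g^T * gamma i * g in
    \sum_i (F i a b * F i c d - F i a c * F i b d + F i a d * F i b c) =
    \sum_i (gamma i a b * gamma i c d - gamma i a c * gamma i b d
            + gamma i a d * gamma i b c)) ->
  forall j, exists u, g^T * gamma j * g = gam u.
Proof.
move=> gg gF j; pose F i := g^T * gamma i * g; pose X := F j.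
have gg' : g * g^T = 1 := mulmx1C gg.
have FT i : (F i)^T = - F i.
  by rewrite /F !trmx_mul trmxK gamma_tr mulmxA mulmxN mulNmx.
(* All matrices involved are skew, which merges the two sandwich terms into one with factor 2. *)
have contract (H : 'I_7 -> 'M[R]_8) : (forall i, (H i)^T = - H i) ->
    \sum_i (\tr ((H i)^T * X) *: H i - H i * X * (H i)^T + H i * X^T * (H i)^T) =
    - (\sum_i \tr (H i * X) *: H i) + 2 *: \sum_i (H i * X * H i).
  move=> HT; rewrite scaler_sumr -sumrN -big_split; apply: eq_bigr => i _ /=.
  rewrite HT mulNr linearN scaleNr mulrN opprK FT.
  rewrite [H i * - _]mulrN mulrNN -addrA; congr (_ + _).
  by rewrite scaler_nat mulr2n.
have XFG : - (\sum_i \tr (F i * X) *: F i) + 2 *: \sum_i (F i * X * F i) =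
  - (\sum_i \tr (gamma i * X) *: gamma i)
  + 2 *: \sum_i (gamma i * X * gamma i).
  rewrite -!contract//; last exact: gamma_tr.
  apply/matrixP => a b; rewrite -!quartic_contract.
  by apply: eq_bigr => c _; apply: eq_bigr => d _; rewrite -[in RHS]gF.
have FM H i : F i * (g^T * H * g) = g^T * (gamma i * H) * g.
  by rewrite /F !mulrA -(mulrA _ g g^T) gg' mulr1.
have FtrX i : \tr (F i * X) = - (8 * (i == j)%:R).
  rewrite FM mxtrace_mulr !mulrA gg' mul1r -!gam_delta mxtrace_gam.
  by rewrite dot_delta mxE eqxx eq_sym.
have FXF i : F i * X * F i = g^T * (gamma i * gamma j * gamma i) * g.
  by rewrite /X -mulrA [F j * F i]FM [F i * _]FM (mulrA (gamma i)).
(* The sandwich by [gamma i] reverses the i-th coordinate and keeps the others, so the sum has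
   factor 7 - 2 = 5. *)
have sandwich v : \sum_i gamma i * gam v * gamma i = 5 *: gam v.
  under eq_bigr do rewrite -[gamma _]gam_delta gam_sandwich dot_delta
    dotC dot_delta mxE !eqxx scale1r -scalerA gam_delta.
  rewrite sumrB -scaler_sumr -/(gam v) sumr_const card_ord -scaler_nat -scalerBl.
  by congr (_ *: _); ring.
(* Since X is itself [F j], the left side is explicit: 8 from the trace term and 2 * 5 from the
   sandwiches. *)
have {}XFG : 18 *: X = - (\sum_i \tr (gamma i * X) *: gamma i)
  + 2 *: \sum_i (gamma i * X * gamma i).
  rewrite -XFG; under [X in - X]eq_bigr do rewrite FtrX.
  under [X in 2 *: X]eq_bigr do rewrite FXF.
  rewrite (bigD1 j)//= big1 ?addr0 => [|i /negbTE->]; last first.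
    by rewrite mulr0 oppr0 scale0r.
  rewrite eqxx mulr1 scaleNr opprK -mulr_suml -mulr_sumr.
  rewrite -[gamma j]gam_delta sandwich.
  rewrite gam_delta -scalerAr -scalerAl scalerA -scalerDl.
  by congr (_ *: _); ring.
(* The coordinates of the orthogonal projection of X on the span; the scaling comes from
   [\tr (gamma i * gamma i)] being -8. *)
pose u : 'rV[R]_7 := \row_i (- (\tr (gamma i * X) / 8)).
pose Y := X - gam u.
have YT : \sum_i gamma i * Y * gamma i = 9 *: Y.
  under eq_bigr do rewrite mulrBr mulrBl.
  have gamu : - (\sum_i \tr (gamma i * X) *: gamma i) = 8 *: gam u.
    rewrite /gam scaler_sumr -sumrN; apply: eq_bigr => i _.
    by rewrite mxE scalerA -scaleNr; congr (_ *: _); field.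
  move: XFG; rewrite sumrB sandwich gamu => XFG.
  have two : (2%:R : R) != 0 by rewrite pnatr_eq0.
  apply: (scalerI two); rewrite scalerBr -[X in X - _](addKr (8 *: gam u)) -XFG.
  rewrite !scalerBr !scalerA -natrM; apply/matrixP => a b; rewrite !mxE; ring.
exists u; apply/eqP; rewrite -subr_eq0 -/(F j) -/X -/Y.
have norm (Z : 'M[R]_8) : \tr (Z^T * Z) = \sum_a \sum_b Z a b ^+ 2.
  rewrite exchange_big; apply: eq_bigr => b _; rewrite mxE.
  by apply: eq_bigr => a _; rewrite mxE.
have norm_ge0 (Z : 'M[R]_8) : 0 <= \tr (Z^T * Z).
  by rewrite norm; do 2![apply: sumr_ge0 => ? _]; rewrite sqr_ge0.
(* Expanding the nonnegative norm of W - Z, with Z of the same norm as W, gives this case of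
   Cauchy-Schwarz. *)
have WgW (W : 'M[R]_8) i : \tr (W^T * (gamma i * W * gamma i)) <= \tr (W^T * W).
  have := norm_ge0 (W - gamma i * W * gamma i).
  set Z := gamma i * W * gamma i.
  have ZZ : \tr (Z^T * Z) = \tr (W^T * W).
    rewrite /Z !trmx_mulr !gamma_tr !(mulrN, mulNr) opprK mxtrace_mulr.
    rewrite -!mulrA (mulrA (gamma i) (gamma i)) gamma_sq mulN1r !mulrN.
    rewrite linearN /= (mxtrace_mulr (gamma i)) -!mulrA gamma_sq !mulrN mulr1.
    by rewrite linearN opprK mxtrace_mulr.
  have ZY : \tr (Z^T * W) = \tr (W^T * Z).
    by rewrite -mxtrace_tr trmx_mulr trmxK.
  rewrite linearB/= mulrBl !mulrBr !raddfB /= ZZ ZY; lra.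
(* The eigenvalue 9 exceeds the bound 7 coming from the seven terms, so the norm vanishes. *)
have : 9 * \tr (Y^T * Y) <= 7 * \tr (Y^T * Y).
  rewrite -mxtraceZ scalerAr -YT mulr_sumr raddf_sum /=.
  apply: le_trans (ler_sum _ (fun i _ => WgW Y i)) _.
  by rewrite sumr_const card_ord mulr_natl.
move=> Y97; have Y0 : \tr (Y^T * Y) = 0 by have := norm_ge0 Y; lra.
apply/eqP/matrixP => a b; rewrite [RHS]mxE; apply/eqP.
rewrite -[_ == 0](sqrf_eq0 (Y a b)).
move: Y0; rewrite norm => /psumr_eq0P Y0.
have /psumr_eq0P Y0a := Y0 (fun a _ => sumr_ge0 _ (fun b _ => sqr_ge0 _)) a isT.
by rewrite Y0a// => c _; rewrite sqr_ge0.
Qed.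

End GammaVectors.

(** * Orthogonal matrices normalizing the span, as products of unit vectors *)

Section SpinLift.
Variable R : realType.
Local Notation gamma := (@gamma R).
Implicit Types (u v : 'rV[R]_7) (X Y : 'M[R]_8) (s : seq 'rV[R]_7).

Definition unit_vectors s := forall v, v \in s -> dot v v = 1.

Lemma unit_vectors_cons v s :
  unit_vectors (v :: s) <-> dot v v = 1 /\ unit_vectors s.
Proof.
split=> [us | [v1 us] w].
  by split=> [|w ws]; apply: us; rewrite inE ?eqxx ?ws ?orbT.
by rewrite inE => /predU1P[->|/us].
Qed.

Definition gam_prod s : 'M[R]_8 := \prod_(v <- s) gam v.

Lemma gam_prod_orth s : unit_vectors s -> (gam_prod s)^T * gam_prod s = 1.
Proof.
rewrite /gam_prod; elim: s => [_|v s IHs]; first by rewrite big_nil trmx1 mulr1.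
move=> /unit_vectors_cons[v1 /IHs e]; rewrite big_cons trmx_mulr -mulrA.
by rewrite (mulrA _ (gam v)) gam_orth// mul1r.
Qed.

Lemma det_gam_prod s : unit_vectors s -> \det (gam_prod s) = 1.
Proof.
rewrite /gam_prod; elim: s => [_|v s IHs]; first by rewrite big_nil det1.
move=> /unit_vectors_cons[v1 /IHs e]; rewrite big_cons.
by rewrite (det_mulmx (gam v)) e mulr1 det_gam.
Qed.

Definition conj_mx X Y : 'M[R]_8 := X * Y * X^T.

Lemma conj_mxM X Y Z : conj_mx (X * Y) Z = conj_mx X (conj_mx Y Z).
Proof. by rewrite /conj_mx trmx_mulr !mulrA. Qed.

Lemma conj_mx_mul X Y Z : X^T * X = 1 ->
  conj_mx X Y * conj_mx X Z = conj_mx X (Y * Z).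
Proof. by move=> e; rewrite /conj_mx -!mulrA (mulrA _ X) e mul1r. Qed.

Lemma conj_gam u v : dot u u = 1 ->
  conj_mx (gam u) (gam v) = - gam (v - (2 * dot u v) *: u).
Proof.
move=> u1; rewrite /conj_mx gam_tr mulrN gam_sandwich u1 scale1r.
by rewrite [in RHS]linearB [in RHS]linearZ.
Qed.

Lemma conj_gam_span u v : dot u u = 1 ->
  exists w, conj_mx (gam u) (gam v) = gam w.
Proof.
move=> u1; exists (- (v - (2 * dot u v) *: u)).
by rewrite conj_gam// [RHS]linearN.
Qed.

Lemma conj_gam_prod_span s g : unit_vectors s ->
  (forall i, exists w, conj_mx g (gamma i) = gam w) ->
  forall i, exists w, conj_mx (gam_prod s * g) (gamma i) = gam w.
Proof.
move=> us gE i; rewrite /gam_prod; elim: s us => [_|v s IHs].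
  by rewrite big_nil mul1r; exact: gE.
move=> /unit_vectors_cons[v1 /IHs[w ew]]; rewrite big_cons -mulrA conj_mxM ew.
exact: conj_gam_span.
Qed.

(* Cartan-Dieudonne: the reflection taking v to e_k fixes every e_i
   orthogonal to both, in particular those with i < k. *)
Lemma conj_gamma_reduce g (k : nat) : g^T * g = 1 ->
  (forall i, exists w, conj_mx g (gamma i) = gam w) -> (k <= 7)%N ->
  exists2 s, unit_vectors s &
    forall i : 'I_7, (i < k)%N ->
      conj_mx (gam_prod s * g) (gamma i) = (-1) ^+ size s * gamma i.
Proof.
move=> gg gE; elim: k => [_|k IHk k7]; first by exists [::].
have [s us sk] := IHk (ltnW k7); pose j := Ordinal k7.
pose h := gam_prod s * g.
have hh : h^T * h = 1.
  by rewrite trmx_mulr -mulrA (mulrA _ (gam_prod s)) gam_prod_orth// mul1r.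
have hh' : h * h^T = 1 := mulmx1C hh.
have conjM Y Z := @conj_mx_mul h Y Z hh.
have [w ew] := conj_gam_prod_span us gE j.
(* Each conjugation by a unit [gam] is minus a reflection; removing the accumulated sign leaves the
   vector to be reflected to e_k. *)
pose v := (-1) ^+ size s *: w.
have ev : conj_mx h (gamma j) = (-1) ^+ size s * gam v.
  rewrite /h ew [in RHS]linearZ /= -[in RHS]signr_odd -[in X in X *: _]signr_odd.
  by rewrite mulr_sign scaler_sign; case: odd; rewrite ?opprK.
have eps2 : (-1) ^+ size s * (-1) ^+ size s = 1 :> 'M[R]_8.
  by rewrite -expr2 sqrr_sign.
have epsC X : X * (-1) ^+ size s = (-1) ^+ size s * X by rewrite commr_sign.
have v1 : dot v v = 1.
  have := conjM (gamma j) (gamma j).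
  rewrite ev gamma_sq mulrA -(mulrA _ (gam v)) epsC mulrA eps2 mul1r gam_sq.
  rewrite /conj_mx mulrN mulr1 mulNr hh'.
  move=> /eqP; rewrite eqr_opp => /eqP/matrixP/(_ 0 0).
  by rewrite !mxE eqxx mulr1n mulr1.
(* Conjugation by h preserves anticommutation, so v is orthogonal to the e_i already fixed. *)
have v0 (i : 'I_7) : (i < k)%N -> v 0 i = 0.
  move=> ik.
  have : gam v * gamma i = - (gamma i * gam v).
    have ij : j != i by rewrite -(inj_eq val_inj) gtn_eqF.
    have := congr1 (conj_mx h) (gamma_anti R ij).
    rewrite {2}/conj_mx mulrN mulNr -/(conj_mx _ _) -!conjM ev (sk i ik).
    rewrite !mulrA -!(mulrA _ (gam v)) -!(mulrA _ (gamma i)) !epsC !mulrA.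
    by rewrite !eps2 !mul1r.
  rewrite -gam_delta gam_anti => /eqP; rewrite -subr_eq0 addrAC subrr add0r.
  rewrite oppr_eq0 scaler_eq0 oner_eq0 orbF mulf_eq0 pnatr_eq0 /= dot_delta.
  by move/eqP.
(* If v is already the target, the difference d below vanishes and cannot be normalized; s then
   serves unchanged. *)
have [vj|vj] := eqVneq v (delta_mx 0 j).
  exists s => // i; rewrite ltnS leq_eqVlt => /predU1P[ik|/sk//].
  have -> : i = j by apply/val_inj.
  by rewrite [LHS]ev vj gam_delta.
pose d := v - delta_mx 0 j.
have jj : (delta_mx 0 j : 'rV[R]_7) 0 j = 1 by rewrite mxE !eqxx.
have dd : dot d d = 2 - 2 * v 0 j.
  rewrite /d dotBr !dotBl v1 (dotC (delta_mx _ _) v) !dot_delta jj; ring.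
have d0 : 0 < dot d d by rewrite lt_neqAle dot_ge0 eq_sym dot_eq0 subr_eq0 vj.
pose a := (Num.sqrt (dot d d))^-1; pose u := a *: d.
have a2 : a ^+ 2 = (dot d d)^-1 by rewrite exprVn sqr_sqrtr ?ltW.
have u1 : dot u u = 1.
  by rewrite /u dotZl dotZr mulrA -expr2 a2 mulVf// gt_eqF.
have uv : v - (2 * dot u v) *: u = delta_mx 0 j.
  have -> : (2 * dot u v) *: u = d.
    rewrite {2}/u scalerA.
    have -> : 2 * dot u v * a = a ^+ 2 * (2 * dot d v) by rewrite dotZl; ring.
    have -> : dot d v = 1 - v 0 j by rewrite dotBl v1 dotC dot_delta.
    by rewrite a2 mulrBr mulr1 -dd mulVf ?scale1r// gt_eqF.
  by rewrite /d opprB addrC subrK.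
exists (u :: s); first exact/unit_vectors_cons.
move=> i ik; rewrite /gam_prod big_cons -mulrA conj_mxM -/(gam_prod s) -/h.
have conjS X : conj_mx (gam u) ((-1) ^+ size s * X) =
    (-1) ^+ size s * conj_mx (gam u) X.
  by rewrite /conj_mx mulrA commr_sign -!mulrA.
move: ik; rewrite ltnS leq_eqVlt => /predU1P[ik|ik].
  have -> : i = j by apply/val_inj.
  rewrite ev conjS conj_gam// uv gam_delta exprS.
  by rewrite mulN1r mulNr mulrN.
rewrite sk// conjS -[gamma i]gam_delta conj_gam// dot_delta.
have -> : u 0 i = 0.
  rewrite -[u 0 i]dot_delta dotZl dotBl !dot_delta v0// mxE.
  have -> : (i == j) = false by rewrite -(inj_eq val_inj) ltn_eqF.
  by rewrite andbF subr0 mulr0.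
by rewrite mulr0 scale0r subr0 gam_delta exprS mulN1r mulNr mulrN.
Qed.

Lemma spin_lift g : g^T * g = 1 ->
  (forall i, exists w, conj_mx g^T (gamma i) = gam w) ->
  exists s, [/\ unit_vectors s, ~~ odd (size s) & g = gam_prod s].
Proof.
move=> gg gE; have gg' : g^T^T * g^T = 1 by rewrite trmxK; exact: mulmx1C gg.
have [s us sg] := conj_gamma_reduce gg' gE (leqnn 7).
pose h := gam_prod s * g^T.
have hh : h^T * h = 1.
  by rewrite trmx_mulr -mulrA (mulrA _ (gam_prod s)) gam_prod_orth// mul1r.
have hgamma i : h * gamma i = (-1) ^+ size s * (gamma i * h).
  by rewrite mulrA -sg// -/h /conj_mx -[RHS]mulrA hh mulr1.
(* Were the length odd, h would anticommute with each of the seven gammas, hence with their product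
   -1, forcing h = 0. *)
have even_s : ~~ odd (size s).
  apply/negP => odd_s.
  have hP t : h * \prod_(i <- t) gamma i =
      (-1) ^+ size t * ((\prod_(i <- t) gamma i) * h).
    elim: t => [|i t IHt]; first by rewrite big_nil !mul1r mulr1.
    rewrite big_cons (mulrA h) hgamma -signr_odd odd_s expr1 mulN1r mulNr.
    rewrite -(mulrA _ h) IHt /= exprS mulN1r mulNr; congr (- _).
    by rewrite (mulrA (gamma i)) commr_sign -!mulrA.
  have := hP (enum 'I_7); rewrite gamma_prod size_enum_ord -signr_odd expr1.
  rewrite mulrN1 !mulN1r opprK => hN.
  have h0 : h = 0.
    apply/matrixP => a b; rewrite [RHS]mxE.
    by have := congr1 (fun X : 'M[R]_8 => X a b) hN; rewrite /= [LHS]mxE; lra.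
  by move: hh; rewrite h0 mulr0 => /eqP; rewrite eq_sym oner_eq0.
have hC i : h * gamma i = gamma i * h.
  by rewrite hgamma -signr_odd (negbTE even_s) mul1r.
have eh := gamma_commutant hC; set c := h 0 0 in eh.
have c1 : c ^+ 2 == 1.
  move: hh => /matrixP/(_ 0 0); rewrite eh tr_scalar_mx -[_ * _]/(_ *m _).
  by rewrite -scalar_mxM !mxE !eqxx !mulr1n expr2 => ->.
have eg : gam_prod s = c%:M * g.
  by rewrite -eh /h -mulrA gg mulr1.
move: c1 eg; rewrite sqrf_eq1 => /orP[]/eqP-> eg.
  by exists s; split => //; rewrite eg mul1r.
(* When h = -1, the missing sign is the square of [gam e], and the length stays even. *)
pose e : 'rV[R]_7 := delta_mx 0 0.
have e1 : dot e e = 1 by rewrite dot_delta mxE !eqxx.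
exists [:: e, e & s]; split.
- by do 2![apply/unit_vectors_cons; split=> //].
- by rewrite /= negbK.
rewrite /gam_prod !big_cons -/(gam_prod s) eg mulrA gam_sq e1 scale1r mulrA.
by rewrite raddfN /= mulN1r opprK mul1r.
Qed.

End SpinLift.

(** * Increasing multi-indices, over which the Hodge star sums *)

Definition increasing (k n : nat) (J : 'I_k -> 'I_n) : bool :=
  [forall i : 'I_k, forall j : 'I_k, (i < j)%N ==> (J i < J j)%N].

Lemma increasing_lt k n (J : 'I_k -> 'I_n) (i j : 'I_k) :
  increasing J -> (i < j)%N -> (J i < J j)%N.
Proof. by move=> /forallP/(_ i)/forallP/(_ j)/implyP. Qed.

Lemma increasing_inj k n (J : 'I_k -> 'I_n) : increasing J -> injective J.
Proof.
move=> iJ i j e; case: (ltngtP i j) => [ij|ji|/val_inj//].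
  by have := increasing_lt iJ ij; rewrite e ltnn.
by have := increasing_lt iJ ji; rewrite e ltnn.
Qed.

(** An increasing family is the sorted list of its values, and both lists have length k, so
    inclusion already forces equality. *)
Lemma increasing_codom_inj k n (I J : {ffun 'I_k -> 'I_n}) :
  increasing I -> increasing J -> {subset codom I <= codom J} -> I = J.
Proof.
move=> iI iJ sIJ.
have sorted_codom (K : {ffun 'I_k -> 'I_n}) : increasing K ->
    sorted (relpre val ltn) (codom K).
  move=> iK; rewrite /codom /image_mem sorted_map.
  have : sorted (relpre val ltn) (enum 'I_k).
    by rewrite -sorted_map val_enum_ord iota_ltn_sorted.
  by apply: sub_sorted => i j; exact: increasing_lt.
have codomE : codom I = codom J.
  apply: (@irr_sorted_eq _ (relpre val ltn)).
  - by move=> x y z /=; exact: ltn_trans.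
  - by move=> x /=; rewrite ltnn.
  - exact: sorted_codom.
  - exact: sorted_codom.
  apply: (uniq_min_size _ sIJ _).2; last by rewrite !size_codom.
  apply: (@sorted_uniq _ (relpre val ltn)); last exact: sorted_codom.
    by move=> x y z /=; exact: ltn_trans.
  by move=> x /=; rewrite ltnn.
by apply/ffunP => i; move/eq_in_map: codomE => /(_ i); apply; rewrite mem_enum.
Qed.

(** * The Cayley form in coordinates and in terms of the gamma matrices *)

Section Minors.
Variable R : realType.

(** Only J = I contributes: any other increasing J misses some value of I, which leaves a zero row
    in the matrix of pairings. *)
Lemma hodge_wedge_basis k l (I : {ffun 'I_k -> 'I_(k + l)}) (W : 'M[R]_(k + l, l)) :
  increasing I ->
  hodge (wedge (rowsub I 1%:M)) W = \det (row_mx (colsub I 1%:M) W).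
Proof.
move=> iI; rewrite /hodge (bigD1 I)//= big1 => [|J /andP[iJ IJ]].
  rewrite addr0 /wedge [X in \det X](_ : _ = 1%:M) ?det1 ?mul1r//.
  apply/matrixP => i j; rewrite !mxE (bigD1 (I i))//= big1 => [|m mI].
    rewrite !mxE eqxx mul1r addr0; congr (_%:R).
    have [->|ij] := eqVneq i j; first by rewrite eqxx.
    by rewrite (inj_eq (increasing_inj iI)) (negbTE ij).
  by rewrite !mxE eq_sym (negbTE mI) mul0r.
have [i iJn] : exists i, I i \notin codom J.
  apply/existsP; apply: contraNT IJ => /existsPn h; apply/eqP/esym.
  apply: increasing_codom_inj => //.
  by move=> _ /codomP[i ->]; have := h i; rewrite negbK.
rewrite /wedge (expand_det_row _ i) big1 ?mul0r// => j _.
rewrite !mxE big1 ?mul0r// => m _; rewrite !mxE.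
have [<-|] := eqVneq (I i) m; last by rewrite mul0r.
rewrite mul1r; case: eqVneq => // e; by move: iJn; rewrite e codom_f.
Qed.

Lemma det_col0_basis n (M : 'M[R]_n.+1) (p : 'I_n.+1) :
  (forall i, M i 0 = (i == p)%:R) ->
  \det M = (-1) ^+ p * \det (\matrix_(i, j) M (lift p i) (lift 0 j)).
Proof.
move=> Mp; rewrite (expand_det_col _ 0) (bigD1 p)//= big1 => [|i /negbTE ip].
  rewrite Mp eqxx mul1r addr0 /cofactor addn0; congr (_ * \det _).
  by apply/matrixP => i j; rewrite !mxE.
by rewrite Mp ip mul0r.
Qed.

(** The basis columns are expanded one at a time: [p1], [p2], [p3] are positions among the rows that
    remain, and each expansion contributes the sign of its position. *)
Lemma det_row_mx_basis (p0 : 'I_8) (p1 : 'I_7) (p2 : 'I_6) (p3 : 'I_5)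
    (B W : 'M[R]_(8, 4)) :
  (forall i j, B i j = (i == nth p0 [:: p0; lift p0 p1; lift p0 (lift p1 p2);
                                  lift p0 (lift p1 (lift p2 p3))] j)%:R) ->
  \det (row_mx B W) = (-1) ^+ (p0 + p1 + p2 + p3) *
    \det (\matrix_(i < 4, j < 4) W (lift p0 (lift p1 (lift p2 (lift p3 i)))) j).
Proof.
move=> Be.
have Bl (i j : 'I_8) (j' : 'I_4) : j = j' :> nat -> row_mx B W i j = B i j'.
  by move=> e; rewrite -(row_mxEl B W); congr (row_mx B W _ _); apply/val_inj.
have Wr (i j : 'I_8) (j' : 'I_4) : j = (4 + j')%N :> nat -> row_mx B W i j = W i j'.
  by move=> e; rewrite -(row_mxEr B W); congr (row_mx B W _ _); apply/val_inj.
rewrite (@det_col0_basis 7 _ p0) => [|i]; last by rewrite (Bl _ _ 0) ?Be.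
rewrite (@det_col0_basis 6 _ p1) => [|i]; last first.
  by rewrite mxE (Bl _ _ (inord 1)) ?inordK// Be inordK//= (inj_eq lift_inj).
rewrite (@det_col0_basis 5 _ p2) => [|i]; last first.
  by rewrite 2!mxE (Bl _ _ (inord 2)) ?inordK// Be inordK//= !(inj_eq lift_inj).
rewrite (@det_col0_basis 4 _ p3) => [|i]; last first.
  by rewrite 3!mxE (Bl _ _ (inord 3)) ?inordK// Be inordK//= !(inj_eq lift_inj).
rewrite !mulrA -!exprD; congr (_ * \det _).
by apply/matrixP => i j; rewrite 4!mxE [RHS]mxE; exact: Wr.
Qed.

(** Entries are indexed by [nat] so that the bumped indices of an expansion compute to numerals. *)
Definition det_fun n (F : nat -> nat -> R) : R :=
  \det (\matrix_(i < n, j < n) F i j).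

Lemma det_funS n F :
  det_fun n.+1 F =
  \sum_(j < n.+1)
    F 0%N j * ((-1) ^+ j * det_fun n (fun i k => F i.+1 (bump j k))).
Proof.
rewrite /det_fun (expand_det_row _ 0); apply: eq_bigr => j _.
rewrite mxE /cofactor add0n; congr (_ * (_ * \det _)).
by apply/matrixP => p q; rewrite !mxE.
Qed.

Definition diag4 (F : nat -> nat -> R) (a b c d : nat) : R :=
  F 0%N a * F 1%N b * F 2%N c * F 3%N d.

Lemma det_fun4 (F : nat -> nat -> R) :
  det_fun 4 F =
    diag4 F 0 1 2 3 - diag4 F 0 1 3 2 - diag4 F 0 2 1 3
    + diag4 F 0 2 3 1 + diag4 F 0 3 1 2 - diag4 F 0 3 2 1
    - diag4 F 1 0 2 3 + diag4 F 1 0 3 2 + diag4 F 1 2 0 3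
    - diag4 F 1 2 3 0 - diag4 F 1 3 0 2 + diag4 F 1 3 2 0
    + diag4 F 2 0 1 3 - diag4 F 2 0 3 1 - diag4 F 2 1 0 3
    + diag4 F 2 1 3 0 + diag4 F 2 3 0 1 - diag4 F 2 3 1 0
    - diag4 F 3 0 1 2 + diag4 F 3 0 2 1 + diag4 F 3 1 0 2
    - diag4 F 3 1 2 0 - diag4 F 3 2 0 1 + diag4 F 3 2 1 0.
Proof.
rewrite /diag4 !(det_funS, big_ord_recl, big_ord0) /det_fun !det_mx00 /=.
by rewrite /bump /=; ring.
Qed.

Definition minor4 (V : 'M[R]_(8, 4)) (s : seq nat) : R :=
  det_fun 4 (fun i j => V (inord (nth 0%N s i)) (inord j)).

(* The lifts enumerate the multi-index s and its complement t, and the sign is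
   that of the permutation (s, t). *)
Lemma self_dual4E (p0 p1 p2 p3 : nat) (V : 'M[R]_(8, 4)) :
  (p0 <= p1)%N -> (p1 <= p2)%N -> (p2 <= p3)%N -> (p3 < 5)%N ->
  self_dual4 p0.+1 p1.+2 p2.+3 p3.+4 V =
  minor4 V [:: p0; p1.+1; p2.+2; p3.+3] + (-1) ^+ (p0 + p1 + p2 + p3) *
  minor4 V [seq bump p0 (bump p1 (bump p2 (bump p3 i))) | i <- iota 0 4].
Proof.
move=> p01 p12 p23 p34.
pose q3 : 'I_5 := Ordinal p34.
have p24 : (p2 < 6)%N by rewrite (leq_ltn_trans p23)// ltnW.
pose q2 : 'I_6 := Ordinal p24.
have p14 : (p1 < 7)%N by rewrite (leq_ltn_trans p12)// ltnW.
pose q1 : 'I_7 := Ordinal p14.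
have p04 : (p0 < 8)%N by rewrite (leq_ltn_trans p01)// ltnW.
pose q0 : 'I_8 := Ordinal p04.
pose I : {ffun 'I_4 -> 'I_8} := [ffun k : 'I_4 => nth q0
  [:: q0; lift q0 q1; lift q0 (lift q1 q2); lift q0 (lift q1 (lift q2 q3))] k].
have IE (k : 'I_4) : I k = nth 0%N [:: p0; p1.+1; p2.+2; p3.+3] k :> nat.
  rewrite ffunE; case: k => -[|[|[|[|k]]]] //= _.
  - by rewrite /bump p01.
  - by rewrite /bump; lia.
  - by rewrite /bump; lia.
have incI : increasing I.
  apply/forallP => i; apply/forallP => j; apply/implyP; rewrite !IE.
  case: i j => -[|[|[|[|i]]]] // _ [[|[|[|[|j]]]]] //= _ _; lia.
have wE : wedge4 p0.+1 p1.+2 p2.+3 p3.+4 = wedge (rowsub I 1%:M) :> Defs.form R 4 8.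
  congr wedge; apply/matrixP => i j.
  rewrite !mxE -[I i == j](inj_eq val_inj) /= IE.
  by case: i => -[|[|[|[|i]]]] //= _; rewrite mxE eqSS eq_sym.
rewrite /self_dual4 /= wE; congr (_ + _).
  rewrite /wedge /minor4 /det_fun; congr (\det _); apply/matrixP => i j.
  rewrite mxE (bigD1 (I i))//= big1 => [|m mI]; last first.
    by rewrite !mxE eq_sym (negbTE mI) mul0r.
  rewrite !mxE eqxx mul1r addr0 -IE inord_val; congr (V _ _).
  by rewrite inord_val.
rewrite (@hodge_wedge_basis 4 4)// (@det_row_mx_basis q0 q1 q2 q3) => [|i j].
  congr (_ * \det _); apply/matrixP => i j; rewrite !mxE inord_val; congr (V _ _).
  by rewrite -[LHS]inord_val; congr inord; case: i => -[|[|[|[|i]]]].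
by rewrite !mxE ffunE.
Qed.

Definition quartic (B : 'I_7 -> 'I_4 -> 'I_4 -> R) : R :=
  \sum_i (B i (inord 0) (inord 1) * B i (inord 2) (inord 3)
         - B i (inord 0) (inord 2) * B i (inord 1) (inord 3)
         + B i (inord 0) (inord 3) * B i (inord 1) (inord 2)).

(** A polynomial identity in the 32 entries of V. The factor 3 shows on the first four basis
    vectors, where each of the three pairings contributes 1. *)
Lemma cayleyE (V : 'M[R]_(8, 4)) :
  3 * cayley_form R V = quartic (fun i => V^T *m gamma R i *m V).
Proof.
have -> : cayley_form R V =
  minor4 V [:: 0; 1; 2; 3] + minor4 V [:: 4; 5; 6; 7] +
  (minor4 V [:: 0; 1; 4; 5] + minor4 V [:: 2; 3; 6; 7]) +
  (minor4 V [:: 0; 1; 6; 7] + minor4 V [:: 2; 3; 4; 5]) +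
  (minor4 V [:: 0; 2; 4; 6] + minor4 V [:: 1; 3; 5; 7]) -
  (minor4 V [:: 0; 2; 5; 7] + minor4 V [:: 1; 3; 4; 6]) -
  (minor4 V [:: 0; 3; 4; 7] + minor4 V [:: 1; 2; 5; 6]) -
  (minor4 V [:: 0; 3; 5; 6] + minor4 V [:: 1; 2; 4; 7]).
  rewrite /cayley_form /=.
  (* [self_dual4E] takes the four indices diminished by 1, 2, 3 and 4. *)
  rewrite (@self_dual4E 0 0 0 0)// (@self_dual4E 0 0 2 2)//.
  rewrite (@self_dual4E 0 0 4 4)//.
  rewrite (@self_dual4E 0 1 2 3)// (@self_dual4E 0 1 3 4)// (@self_dual4E 0 2 2 4)//.
  rewrite (@self_dual4E 0 2 3 3)//.
  by rewrite /bump /= !(exprS, expr0) !(mulN1r, opprK, mul1r).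
pose x (a b : nat) := V (inord a) (inord b).
pose B (i p q : nat) := \sum_(0 <= r < 8)
  (-1) ^+ gamma_neg i r * x r p * x (gamma_col i r) q.
have BE (i : 'I_7) (p q : nat) :
    (V^T *m gamma R i *m V) (inord p) (inord q) = B i p q.
  rewrite /B big_mkord -mulmxA mxE; apply: eq_bigr => r _.
  by rewrite gamma_mulmx mxE mulrCA mulrA /x inord_val.
rewrite /quartic.
under eq_bigr do rewrite !BE.
rewrite -(big_mkord xpredT (fun i => B i 0%N 1%N * B i 2%N 3%N
  - B i 0%N 2%N * B i 1%N 3%N + B i 0%N 3%N * B i 1%N 2%N)).
have B8 i p q : let t r := (-1) ^+ gamma_neg i r * x r p * x (gamma_col i r) q in
    B i p q = t 0%N + t 1%N + t 2%N + t 3%N + t 4%N + t 5%N + t 6%N + t 7%N.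
  by rewrite /B /index_iota /= !big_cons big_nil addr0 !addrA.
have minorE r : minor4 V r = det_fun 4 (fun i j => x (nth 0%N r i) j) by [].
rewrite !minorE !det_fun4 /diag4 {minorE} /index_iota [iota _ _]/= !big_cons big_nil.
rewrite addr0 !B8 {B8 BE} /nth; clear B; move: x => x.
(* Signs and columns are evaluated to literals, so that only a polynomial identity is left for
   [ring]. *)
repeat match goal with |- context [gamma_neg ?i ?r] =>
  let b := eval vm_compute in (gamma_neg i r) in change (gamma_neg i r) with b end.
repeat match goal with |- context [gamma_col ?i ?r] =>
  let b := eval vm_compute in (gamma_col i r) in change (gamma_col i r) with b end.
rewrite !expr0 !expr1.

ring.
Qed.

End Minors.

(** * Invariance of the Cayley form under unit vectors, and the converse *)

Section CayleySpin.
Variable R : realType.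
Local Notation gamma := (@gamma R).
Implicit Types (u v : 'rV[R]_7) (X Y : 'M[R]_8) (s : seq 'rV[R]_7).

Lemma reflection_dot u x y : dot u u = 1 ->
  dot (x - (2 * dot u x) *: u) (y - (2 * dot u y) *: u) = dot x y.
Proof.
by move=> u1; rewrite dotBl !dotBr !dotZl !dotZr u1 (dotC x u); ring.
Qed.

(** Collecting the seven values into vectors of R^7 makes the invariance of [quartic] under
    isometries of R^7 visible. *)
Lemma quarticE (B : 'I_7 -> 'I_4 -> 'I_4 -> R) :
  let b p q : 'rV[R]_7 := \row_i B i (inord p) (inord q) in
  quartic B = dot (b 0%N 1%N) (b 2%N 3%N) - dot (b 0%N 2%N) (b 1%N 3%N)
            + dot (b 0%N 3%N) (b 1%N 2%N).
Proof.
rewrite /quartic /dot -sumrB -big_split; apply: eq_bigr => i _ /=.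
by rewrite !mxE.
Qed.

Lemma cayley_gam u (V : 'M[R]_(8, 4)) : dot u u = 1 ->
  cayley_form R (gam u *m V) = cayley_form R V.
Proof.
move=> u1; apply: (@mulfI _ 3); first by rewrite pnatr_eq0.
rewrite !cayleyE.
pose b p q : 'rV[R]_7 := \row_i (V^T *m gamma i *m V) p q.
(* [gam u] acts on the vectors [b p q] by minus a reflection; the sign cancels because [quartic] is
   quadratic in them. *)
have BE i p q : ((gam u *m V)^T *m gamma i *m (gam u *m V)) p q =
    - (b p q - (2 * dot u (b p q)) *: u) 0 i.
  have -> : (gam u *m V)^T *m gamma i *m (gam u *m V) =
      - (V^T *m gamma i *m V - (2 * u 0 i) *: (V^T *m gam u *m V)).
    have -> : (gam u *m V)^T *m gamma i *m (gam u *m V) =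
              V^T *m ((gam u)^T *m gamma i *m gam u) *m V.
      by rewrite trmx_mul !mulmxA.
    have -> : (gam u)^T *m gamma i *m gam u =
              - (gamma i - (2 * u 0 i) *: gam u).
      rewrite gam_tr !mulNmx -[gamma i]gam_delta [_ *m _ *m _]gam_sandwich.
      by rewrite u1 scale1r dot_delta.
    by rewrite mulmxN mulNmx mulmxBr mulmxBl -scalemxAr -scalemxAl.
  have -> : dot u (b p q) = (V^T *m gam u *m V) p q.
    rewrite /dot /gam mulmx_sumr mulmx_suml summxE; apply: eq_bigr => j _.
    by rewrite -scalemxAr -scalemxAl !mxE.
  by rewrite !mxE; ring.
rewrite !quarticE.
have rowE p q : \row_i ((gam u *m V)^T *m gamma i *m (gam u *m V)) p q =
    (-1) *: (b p q - (2 * dot u (b p q)) *: u) :> 'rV[R]_7.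
  by apply/rowP => i; rewrite mxE BE scaleN1r [RHS]mxE.
rewrite !rowE !(dotZl (-1)) !(dotZr (-1)) !reflection_dot//.
by rewrite !mulrA !mulrNN !mul1r.
Qed.

Lemma cayley_gam_prod s (V : 'M[R]_(8, 4)) : unit_vectors s ->
  cayley_form R (gam_prod s *m V) = cayley_form R V.
Proof.
rewrite /gam_prod; elim: s => [|v s IHs]; first by rewrite big_nil mul1mx.
move=> /unit_vectors_cons[v1 /IHs e]; rewrite big_cons.
by rewrite -[gam v * _]/(gam v *m _) -mulmxA cayley_gam.
Qed.

Lemma form_act_fixedP k n (g : 'M[R]_n) (a : Defs.form R k n) : g \in unitmx ->
  form_act g a = a <-> forall V, a (g *m V) = a V.
Proof.
move=> ug; split=> [e V | e]; first by rewrite -[in LHS]e /form_act mulKmx.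
by apply/funext => V; rewrite /form_act -[LHS]e mulKVmx.
Qed.

Lemma cayley_fixed_spin g : g^T * g = 1 ->
  (forall V, cayley_form R (g *m V) = cayley_form R V) ->
  exists s, [/\ unit_vectors s, ~~ odd (size s) & g = gam_prod s].
Proof.
move=> gg gV; apply: spin_lift => // i; rewrite /conj_mx trmxK.
apply: gamma_span => // a b c d F.
(* Evaluation on the basis vectors with indices a, b, c, d gives the entrywise hypothesis of
   [gamma_span]. *)
pose J := [ffun k : 'I_4 => nth a [:: a; b; c; d] k].
have subE M (p q : 'I_4) : ((colsub J 1%:M)^T *m M *m colsub J 1%:M) p q =
    M (J p) (J q) :> R.
  by rewrite trmx_mxsub trmx1 mul_rowsub_mx mul1mx mulmx_colsub mulmx1 !mxE.
have := gV (colsub J 1%:M) => /(congr1 ( *%R 3)); rewrite !cayleyE /quartic.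
have gE k : (g *m colsub J 1%:M)^T *m gamma k *m (g *m colsub J 1%:M) =
            (colsub J 1%:M)^T *m F k *m colsub J 1%:M.
  by rewrite trmx_mul !mulmxA.
under eq_bigr do rewrite !gE !subE.
under [RHS]eq_bigr do rewrite !subE.
by rewrite !ffunE !inordK.
Qed.

End CayleySpin.

(** * The even part of the Clifford algebra and the trace form *)

Section EvenPart.
Variable R : realType.

Lemma odd_card_symdiff n (S T : {set 'I_n}) :
  odd #|symdiff S T| = odd #|S| (+) odd #|T|.
Proof.
have -> : symdiff S T = (S :\: T) :|: (T :\: S).
  by apply/setP => i; rewrite !inE; case: (i \in S); case: (i \in T).
rewrite cardsU (_ : _ :&: _ = finset.set0) ?cards0 ?subn0; last first.
  by apply/setP => i; rewrite !inE; case: (i \in S); case: (i \in T).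
rewrite oddD -(cardsID T S) -(cardsID S T) !oddD finset.setIC.
by rewrite addbACA addbb addFb.
Qed.

(** A vector has degree one, so each factor shifts the parity of the degrees. *)
Lemma prod_cliff_vec_parity n (s : seq 'rV[R]_n) (S : {set 'I_n}) :
  odd #|S| != odd (size s) -> (\prod_(v <- s) cliff_vec v) S = 0.
Proof.
elim: s S => [|v s IHs] S.
  rewrite big_nil ffunE; have [->|//] := eqVneq S finset.set0.
  by rewrite cards0.
move=> oS; rewrite big_cons [LHS]cliff_mulE big1// => T _.
rewrite /cliff_vec sum_ffunE.
have [oT|eT] := boolP (odd #|T|).
  rewrite IHs ?mulr0// odd_card_symdiff oT /=.
  by move: oS; rewrite /= -[in X in X -> _](negbK (odd #|S|)) (inj_eq negb_inj).
rewrite big1 ?mulr0 ?mul0r// => i _; rewrite !ffunE.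
case: eqVneq => [Ti|_]; last by rewrite /GRing.scale /= mulr0.
by move: eT; rewrite Ti cards1.
Qed.

Local Notation gamma := (@gamma R).
Let A : algType R := 'M[R]_8.
Local Notation gmonom := (@cliff_monom R 7 A gamma).
Local Notation rho := (@cliff_rep R 7 A gamma).

Implicit Types (i : 'I_7) (S T : {set 'I_7}).

Lemma gmonom_orth S : (gmonom S)^T * gmonom S = 1.
Proof.
rewrite /cliff_monom; elim: (enum 'I_7) => [|i s IHs].
  by rewrite big_nil trmx1 mulr1.
rewrite big_cons; case: ifP => // _; rewrite trmx_mulr gamma_tr mulrN mulNr.
by rewrite -!mulrA (mulrA (gamma i)) gamma_sq mulN1r mulrN opprK.
Qed.

(** For S of even size, [S :\ i] is odd exactly when i lies in S. *)
Lemma gmonom_comm i S : ~~ odd #|S| ->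
  gmonom S * gamma i = (-1) ^+ (i \in S) * (gamma i * gmonom S).
Proof.
move=> eS; have oS : odd #|S :\ i| = (i \in S).
  by move: eS; rewrite (cardsD1 i S) oddD oddb; case: (i \in S); case: (odd _).
rewrite (cliff_monom_comm (@gamma_anti R)) -[X in X *: _]signr_odd oS.
by rewrite scaler_sign mulr_sign; case: (i \in S); rewrite ?opprK.
Qed.

Lemma gmonom_tr_comm i S : ~~ odd #|S| ->
  (gmonom S)^T * gamma i = (-1) ^+ (i \in S) * (gamma i * (gmonom S)^T).
Proof.
move=> /(gmonom_comm i)/(congr1 trmx).
rewrite !mulr_sign; case: (i \in S); rewrite ?linearN /= !trmx_mulr gamma_tr.
  by rewrite !(mulNr, mulrN) opprK => <-.
by rewrite mulNr mulrN => /oppr_inj.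
Qed.

(** If i lies in exactly one of S and T, the product anticommutes with [gamma i], so cyclicity makes
    its trace equal to its opposite. Evenness matters: as all seven gammas multiply to -1,
    complementary sets give the same monomial up to sign. *)
Lemma mxtrace_gmonom S T : ~~ odd #|S| -> ~~ odd #|T| ->
  \tr ((gmonom S)^T * gmonom T) = 8 * (S == T)%:R.
Proof.
move=> eS eT; have [<-|ST] := eqVneq S T.
  by rewrite gmonom_orth mxtrace1 mulr1.
rewrite mulr0; have [i iST] : exists i, (i \in S) (+) (i \in T).
  apply/existsP; apply: contraNT ST => /existsPn h; apply/eqP/setP => i.
  by have := h i; rewrite negb_add => /eqP.
have MN : (gmonom S)^T * gmonom T * gamma i =
    - (gamma i * ((gmonom S)^T * gmonom T)).
  rewrite -mulrA gmonom_comm// mulrA commr_sign -mulrA (mulrA (gmonom S)^T).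
  rewrite gmonom_tr_comm// -!mulrA (mulrA ((-1) ^+ (i \in T))).
  by rewrite -signr_addb addbC iST expr1 mulN1r.
move: MN; set M := (gmonom S)^T * gmonom T; move: M => M MN.
have := mxtrace_mulr (M * gamma i) (gamma i).
rewrite -mulrA gamma_sq mulrN1 MN mulrN mulrA gamma_sq mulN1r opprK linearN /=.
lra.
Qed.

(** The coefficients of X in the orthogonal family of even monomials, each of squared trace norm 8.
    Odd coefficients are set to 0 because spin elements are even. *)
Definition even_lift (X : 'M[R]_8) : clifford R 7 :=
  [ffun S : {set 'I_7} => if odd #|S| then 0 else 8^-1 * \tr ((gmonom S)^T * X)].

Lemma even_liftK (x : clifford R 7) :
  (forall S : {set 'I_7}, odd #|S| -> x S = 0) -> even_lift (rho x) = x.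
Proof.
move=> x0; apply/ffunP => S; rewrite ffunE; case: ifPn => [/x0//|eS].
have -> : rho x = \sum_T x T *: gmonom T :> 'M[R]_8 by [].
rewrite [(gmonom S)^T * _]mulr_sumr raddf_sum /= mulr_sumr.
rewrite (bigD1 S)//= big1 => [|T TS].
  by rewrite addr0 -scalerAr mxtraceZ mxtrace_gmonom// eqxx mulr1; field.
have [/x0->|eT] := boolP (odd #|T|); first by rewrite scale0r mulr0 raddf0 mulr0.
by rewrite -scalerAr mxtraceZ mxtrace_gmonom// eq_sym (negbTE TS) !mulr0.
Qed.

Lemma rho_gam_prod s : rho (\prod_(v <- s) cliff_vec v) = gam_prod s.
Proof. by rewrite (cliff_rep_prod_vec (@gamma_sq R) (@gamma_anti R)). Qed.

Lemma even_liftE s : ~~ odd (size s) ->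
  even_lift (gam_prod s) = \prod_(v <- s) cliff_vec v.
Proof.
move=> es; rewrite -rho_gam_prod even_liftK// => S oS.
by apply: prod_cliff_vec_parity; rewrite oS (negbTE es).
Qed.

End EvenPart.

(** * Continuity checked coordinatewise *)

Section Continuity.
Variables (R : realType) (T : topologicalType).

Lemma continuous_sum (I : Type) (r : seq I) (P : pred I) (F : I -> T -> R) :
  (forall i, P i -> continuous (F i)) ->
  continuous (fun t => \sum_(i <- r | P i) F i t).
Proof.
move=> cF t; elim: r => [|i r IHr].
  under eq_fun do rewrite big_nil.
  exact: cvg_cst.
under eq_fun do rewrite big_cons.
case: ifP => // Pi.
by apply: cvgD => //; exact: cF.
Qed.

Lemma continuous_scale (a : R) (f : T -> R) :
  continuous f -> continuous (fun t => a * f t).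
Proof. by move=> cf t; apply: cvgM; [exact: cvg_cst | exact: cf]. Qed.

Lemma continuous_mx m n (F : T -> 'M[R]_(m, n)) :
  (forall i j, continuous (fun t => F t i j)) -> continuous F.
Proof.
move=> cF t A [P Pnbhs sPA].
have h : \forall s \near t, forall i j, P i j (F s i j).
  apply: filter_forall => i; apply: filter_forall => j.
  exact: (cF i j t _ (Pnbhs i j)).
by apply: filterS h => s h; apply: sPA.
Qed.

Lemma continuous_clifford n (F : T -> clifford R n) :
  (forall S, continuous (fun t => F t S)) -> continuous F.
Proof.
move=> cF; apply: continuous_comp_initial => t.
apply/cvg_sup => S; apply: continuous_comp_initial; exact: cF.
Qed.

End Continuity.

(** * The isomorphism, its inverse and their continuity *)

Section Iso.
Variable R : realType.
Let A : algType R := 'M[R]_8.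
Local Notation rho := (@cliff_rep R 7 A (@gamma R)).

Lemma dotE (v : 'rV[R]_7) : dot v v = \sum_i v 0 i ^+ 2.
Proof. by apply: eq_bigr => i _; rewrite expr2. Qed.

Lemma Spin_setE (x : clifford R 7) : Spin_set R 7 x <->
  exists s, [/\ unit_vectors s, ~~ odd (size s) & x = \prod_(v <- s) cliff_vec v].
Proof.
by split=> -[s [us es ->]]; exists s; split=> // v /us; rewrite dotE.
Qed.

Lemma stabilizer_spin (g : cayley_stabilizer R) :
  exists s, [/\ unit_vectors s, ~~ odd (size s) & val (val g) = gam_prod s].
Proof.
have [gg dg] := SO_P (val g); apply: cayley_fixed_spin => //.
apply/form_act_fixedP; first by rewrite unitmxE dg unitr1.
exact: set_mem (valP g).
Qed.

Fact to_spin_subproof (g : cayley_stabilizer R) :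
  even_lift (val (val g)) \in Spin_set R 7.
Proof.
have [s [us es ->]] := stabilizer_spin g.
by apply/mem_set/Spin_setE; exists s; rewrite even_liftE.
Qed.

Definition to_spin (g : cayley_stabilizer R) : Spin R 7 :=
  Sub (even_lift (val (val g))) (to_spin_subproof g).

Fact to_spin_multiplicative : {morph to_spin : g h / (g * h)%g}.
Proof.
move=> g h; apply/val_inj.
have [s [us es gs]] := stabilizer_spin g.
have [t [ut et ht]] := stabilizer_spin h.
change (even_lift (val (val g) * val (val h)) =
        even_lift (val (val g)) * even_lift (val (val h))).
(* Both sides become the Clifford product over the concatenated words. *)
rewrite gs ht /gam_prod -big_cat -/(gam_prod _) !even_liftE//.
  by rewrite big_cat.
by rewrite size_cat oddD (negbTE es) (negbTE et).
Qed.

HB.instance Definition _ :=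
  isMultiplicative.Build (cayley_stabilizer R) (Spin R 7) to_spin
    to_spin_multiplicative.

Fact of_spin_SO_subproof (x : Spin R 7) : rho (val x) \in SO_set R 8.
Proof.
have /Spin_setE[s [us _ ->]] := SpinP x; rewrite rho_gam_prod.
by apply/mem_set; split; [exact: gam_prod_orth | exact: det_gam_prod].
Qed.

Definition of_spin_SO (x : Spin R 7) : SO R 8 :=
  Sub (rho (val x) : 'M[R]_8) (of_spin_SO_subproof x).

Fact of_spin_subproof (x : Spin R 7) :
  of_spin_SO x \in cayley_stabilizer_set R.
Proof.
apply/mem_set.
change (form_act (val (of_spin_SO x)) (cayley_form R) = cayley_form R).
apply/form_act_fixedP; first by rewrite unitmxE (SO_P _).2 unitr1.
move=> V; have /Spin_setE[s [us _ xs]] := SpinP x.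
rewrite -[val (of_spin_SO x)]/(rho (val x)) xs rho_gam_prod.
exact: cayley_gam_prod.
Qed.

Definition of_spin (x : Spin R 7) : cayley_stabilizer R :=
  Sub (of_spin_SO x) (of_spin_subproof x).

Lemma to_spinK : cancel to_spin of_spin.
Proof.
move=> g; do 2!apply/val_inj; change (rho (even_lift (val (val g))) = val (val g)).
have [s [us es gs]] := stabilizer_spin g.
by rewrite gs even_liftE// rho_gam_prod.
Qed.

Lemma of_spinK : cancel of_spin to_spin.
Proof.
move=> x; apply/val_inj; change (even_lift (rho (val x)) = val x).
have /Spin_setE[s [us es ->]] := SpinP x.
by rewrite rho_gam_prod even_liftE.
Qed.

Lemma continuous_stabilizer_entry i j :
  continuous (fun g : cayley_stabilizer R => val (val g) i j).
Proof.
move=> g; apply: (@continuous_comp _ _ _ (fun g : cayley_stabilizer R => val g)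
  (fun h : SO R 8 => val h i j)); first exact: initial_continuous.
apply: (@continuous_comp _ _ _ (fun h : SO R 8 => val h) (fun X : 'M[R]_8 => X i j)).
  exact: initial_continuous.
exact: coord_continuous.
Qed.

Lemma continuous_to_spin : continuous to_spin.
Proof.
apply: continuous_comp_initial; apply: continuous_clifford => S.
change (continuous (fun g : cayley_stabilizer R => even_lift (val (val g)) S)).
under eq_fun do rewrite ffunE.
case: (odd #|S|); first exact: cst_continuous.
apply: continuous_scale; under eq_fun do rewrite /mxtrace.
apply: continuous_sum => i _; under eq_fun do rewrite mxE.
by apply: continuous_sum => j _; apply: continuous_scale;
  exact: continuous_stabilizer_entry.
Qed.

Lemma continuous_spin_coef S : continuous (fun x : Spin R 7 => val x S).
Proof.
move=> x; apply: (@continuous_comp _ _ _ (fun x : Spin R 7 => val x)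
  (fun y : clifford R 7 => y S)); first exact: initial_continuous.
apply: (@continuous_comp _ _ _
  (fun y : clifford R 7 => (fun S => y S) : prod_topology (fun _ => R))
  (fun y => y S)).
  exact: initial_continuous.
exact: proj_continuous.
Qed.

Lemma continuous_of_spin : continuous of_spin.
Proof.
apply: continuous_comp_initial; apply: continuous_comp_initial.
apply: continuous_mx => i j.
change (continuous (fun x : Spin R 7 => (rho (val x) : 'M[R]_8) i j)).
under eq_fun do rewrite summxE.
apply: continuous_sum => S _.
under eq_fun do rewrite mxE mulrC.
by apply: continuous_scale; exact: continuous_spin_coef.
Qed.

End Iso.

Theorem theorem1p3 (R : realType) :
  exists (f : {multiplicative cayley_stabilizer R -> Spin R 7})
         (f' : Spin R 7 -> cayley_stabilizer R),
    [/\ cancel f f', cancel f' f, continuous f & continuous f'].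
Proof.
exists (@to_spin R), (@of_spin R); split.
- exact: to_spinK.
- exact: of_spinK.
- exact: continuous_to_spin.
- exact: continuous_of_spin.
Qed.
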